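(* Let $R>\hat R:=12\,e^{(3e)^{-1}}$ and $T>0$. Then there exists a number $\hat C>0$ such that for all functions $y^0,\widetilde y^0\in\mathcal R_{R,\hat C}\cap\mathcal C$ there exist functions $y\in G^{1,3}([0,1]\times[0,T])$ and $h\in G^3([0,T])$ satisfying $$\partial_ty=\partial_x^3y+\partial_xy+y\,\partial_xy,\quad x\in[0,1],\ t\in[0,T],$$ $$y(1,t)=h(t),\quad y(0,t)=0,\quad \partial_xy(0,t)=0,\quad t\in[0,T],$$ $$y(x,0)=y^0(x),\quad x\in[0,1],$$ together with $y(x,T)=\widetilde y^0(x)$ for all $x\in[0,1]$.
   Context: All functions are real-valued. $\mathcal R_{R,C}$ ($R>1$, $C>0$): functions $z$ on $[-1,1]$ for which there is a sequence $(\alpha_n)_{n\ge0}$ with $|\alpha_n|\le C\,n!/R^n$ for all $n$ and $z(x)=\sum_{n\ge0}\alpha_nx^n/n!$ for all $x\in[-1,1]$. Gevrey classes: $h\in G^s([t_1,t_2])$ if $h\in C^\infty$ and $|h^{(p)}(t)|\le C(p!)^s/R^p$ for some $C,R>0$ and all $p\in\mathbb N$, $t\in[t_1,t_2]$. $y\in G^{s_1,s_2}([x_1,x_2]\times[t_1,t_2])$ if $y\in C^\infty$ and $|\partial_x^{p_1}\partial_t^{p_2}y(x,t)|\le C(p_1!)^{s_1}(p_2!)^{s_2}/(R_1^{p_1}R_2^{p_2})$ for some $C,R_1,R_2>0$, all $(x,t)$ and all $p_1,p_2\in\mathbb N$. Compatibility set $\mathcal C$: in polynomials in variables $y_0,y_1,y_2,\dots$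 (standing for $y,\partial_xy,\partial_x^2y,\dots$), let $D_xG=\sum_i y_{i+1}\partial G/\partial y_i$ and $D_tG=\sum_i \big(D_x^i(y_3+y_1+y_0y_1)\big)\partial G/\partial y_i$. Put $J_{l,1}=D_t^l y_0$ and $J_{l,2}=D_t^ly_1$. (Thus for every smooth solution of the PDE, $\partial_t^ly=J_{l,1}(y,\partial_xy,\dots)$ and $\partial_t^l\partial_xy=J_{l,2}(y,\partial_xy,\dots)$.) Then $\mathcal C$ is the set of $y_0\in C^\infty([0,1])$ such that, for all $l\in\mathbb N$, $J_{l,1}$ and $J_{l,2}$ evaluated at $(y_0(0),\partial_xy_0(0),\partial_x^2y_0(0),\dots)$ vanish. A function in $\mathcal R_{R,C}\cap\mathcal C$ is a function in $\mathcal R_{R,C}$ whose restriction to $[0,1]$ lies in $\mathcal C$. *)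

(* Defs.v *)
(* Stdlib real numbers with Coquelicot. *)
From Stdlib Require Import Reals Factorial.
From Coquelicot Require Import Coquelicot.

Open Scope R_scope.

(* Functions on [a, b] or on a rectangle are total functions of which only the
   values on that set matter.  Derivatives are taken within the set, so they are
   one-sided at the end points; [derive_in a b f x] is meaningful when a < b,
   x is in [a, b] and [ex_derive_in a b f x] holds. *)

Definition is_derive_in (a b : R) (f : R -> R) (x l : R) : Prop :=
  D_in f (fun _ => l) (fun z => a <= z <= b) x.

Definition ex_derive_in (a b : R) (f : R -> R) (x : R) : Prop :=
  exists l : R, is_derive_in a b f x l.

Definition derive_in (a b : R) (f : R -> R) (x : R) : R :=
  iota (is_derive_in a b f x).

Definition derive_in_n (a b : R) (n : nat) (f : R -> R) : R -> R :=
  Nat.iter n (derive_in a b) f.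

Definition smooth_in (a b : R) (f : R -> R) : Prop :=
  forall (n : nat) (x : R), a <= x <= b -> ex_derive_in a b (derive_in_n a b n f) x.

Definition gevrey (s t1 t2 : R) (h : R -> R) : Prop :=
  smooth_in t1 t2 h /\
  exists C rho : R, 0 < C /\ 0 < rho /\
    forall (p : nat) (t : R), t1 <= t <= t2 ->
      Rabs (derive_in_n t1 t2 p h t) <= C * Rpower (INR (fact p)) s / rho ^ p.

Definition partial_x (x1 x2 : R) (y : R -> R -> R) : R -> R -> R :=
  fun x t => derive_in x1 x2 (fun z => y z t) x.

Definition partial_t (t1 t2 : R) (y : R -> R -> R) : R -> R -> R :=
  fun x t => derive_in t1 t2 (fun z => y x z) t.

(* The functions of class C^k on the closed rectangle [x1, x2] * [t1, t2]. *)
Fixpoint class_C (k : nat) (x1 x2 t1 t2 : R) (y : R -> R -> R) : Prop :=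
  continuous_on (fun q : R * R => x1 <= fst q <= x2 /\ t1 <= snd q <= t2)
    (fun q : R * R => y (fst q) (snd q)) /\
  match k with
  | O => True
  | S k' =>
      (forall x t : R, x1 <= x <= x2 -> t1 <= t <= t2 ->
         ex_derive_in x1 x2 (fun z => y z t) x /\
         ex_derive_in t1 t2 (fun z => y x z) t) /\
      class_C k' x1 x2 t1 t2 (partial_x x1 x2 y) /\
      class_C k' x1 x2 t1 t2 (partial_t t1 t2 y)
  end.

Definition gevrey2 (s1 s2 x1 x2 t1 t2 : R) (y : R -> R -> R) : Prop :=
  (forall k : nat, class_C k x1 x2 t1 t2 y) /\
  exists C R1 R2 : R, 0 < C /\ 0 < R1 /\ 0 < R2 /\
    forall (p1 p2 : nat) (x t : R), x1 <= x <= x2 -> t1 <= t <= t2 ->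
      Rabs (Nat.iter p1 (partial_x x1 x2) (Nat.iter p2 (partial_t t1 t2) y) x t)
      <= C * Rpower (INR (fact p1)) s1 * Rpower (INR (fact p2)) s2
           / (R1 ^ p1 * R2 ^ p2).

(* The class R_{rho,C} of functions on [-1, 1]. *)
Definition class_R (rho C : R) (z : R -> R) : Prop :=
  exists alpha : nat -> R,
    (forall n : nat, Rabs (alpha n) <= C * INR (fact n) / rho ^ n) /\
    (forall x : R, -1 <= x <= 1 ->
       is_series (fun n : nat => alpha n * x ^ n / INR (fact n)) (z x)).

(* Polynomial expressions in the countably many variables y_0, y_1, y_2, ...;
   all that follows depends on them only through their evaluations. *)
Inductive jpoly : Type :=
  | JConst (c : R)
  | JVar (i : nat)
  | JAdd (G H : jpoly)
  | JMul (G H : jpoly).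

Fixpoint jeval (v : nat -> R) (G : jpoly) : R :=
  match G with
  | JConst c => c
  | JVar i => v i
  | JAdd G H => jeval v G + jeval v H
  | JMul G H => jeval v G * jeval v H
  end.

(* The variables occurring in G have indices < jwidth G. *)
Fixpoint jwidth (G : jpoly) : nat :=
  match G with
  | JConst _ => 0
  | JVar i => S i
  | JAdd G H => Nat.max (jwidth G) (jwidth H)
  | JMul G H => Nat.max (jwidth G) (jwidth H)
  end.

Fixpoint jpartial (i : nat) (G : jpoly) : jpoly :=
  match G with
  | JConst _ => JConst 0
  | JVar j => JConst (if Nat.eqb i j then 1 else 0)
  | JAdd G H => JAdd (jpartial i G) (jpartial i H)
  | JMul G H => JAdd (JMul (jpartial i G) H) (JMul G (jpartial i H))
  end.

Fixpoint jsum (n : nat) (F : nat -> jpoly) : jpoly :=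
  match n with
  | O => JConst 0
  | S m => JAdd (jsum m F) (F m)
  end.

(* The sums over all i defining D_x G and D_t G stop at jwidth G, the partial
   derivatives with respect to the remaining variables being zero. *)
Definition jDx (G : jpoly) : jpoly :=
  jsum (jwidth G) (fun i => JMul (JVar (S i)) (jpartial i G)).

Definition jkdv : jpoly :=
  JAdd (JAdd (JVar 3) (JVar 1)) (JMul (JVar 0) (JVar 1)).

Definition jDt (G : jpoly) : jpoly :=
  jsum (jwidth G) (fun i => JMul (Nat.iter i jDx jkdv) (jpartial i G)).

Definition J1 (l : nat) : jpoly := Nat.iter l jDt (JVar 0).
Definition J2 (l : nat) : jpoly := Nat.iter l jDt (JVar 1).

Definition jet0 (y0 : R -> R) : nat -> R := fun i => derive_in_n 0 1 i y0 0.

Definition compatible (y0 : R -> R) : Prop :=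
  smooth_in 0 1 y0 /\
  forall l : nat, jeval (jet0 y0) (J1 l) = 0 /\ jeval (jet0 y0) (J2 l) = 0.

(* Main.v *)
Require Import Defs.
From Stdlib Require Import Reals.
From Coquelicot Require Import Coquelicot.
From Stdlib Require Import Arith Factorial FunctionalExtensionality Lra Lia.
Open Scope R_scope.

(** Let theta(t) be the trace y_xx(0, t).  As y and y_x vanish at x = 0, the
    equation, read as an evolution in x (y_xxx = y_t - y_x - y y_x), determines y
    from theta, and h is just the value of that y at x = 1.  So one has to find
    theta such that y exists up to x = 1 and takes the right values at t = 0 and
    at t = T.

    A solution is handled through its jets u(n, l), the derivatives of order n in
    x and l in t at a point.  At (0, 0) the jet can be generated in two ways:
    from the initial data u(n, 0), by the equation solved for y_t ([tjet]), or
    from the rows u(0, .), u(1, .), u(2, .), by the equation solved for y_xxx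
    ([xjet]).  The compatibility conditions say that the first two rows of the
    former jet vanish.  Hence both jets coincide as soon as the derivatives of
    theta at 0 are the third row of [tjet] ([tjet_eq_xjet]), and then y(., 0),
    being analytic, is the initial datum.  The same holds at t = T.

    In the estimates one derivative in t weighs as three in x: all jets are
    compared with A x^n y^l (n + 3 l + 1)!.  For a product of jets such majorants
    only lose a Beta integral ([leib2_bound]), and both recursions preserve them
    if A is small ([tjet_bound], [xjet_bound]).  From the radius 12 > 1 of the
    data this gives prescribed derivatives of theta bounded by a multiple of
    (7/864)^l (3 l + 3)!, while y exists on [0, 1] if theta satisfies such bounds
    with 3/4 instead of 7/864.

    It remains to construct a function with prescribed derivatives at 0 and at T,
    in the Gevrey class of order 3, without losing more than this margin
    ([two_point_borel]).  In the class of order 2, truncated Laplace transforms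
    do this: the integral of exp (- s / t) k(s) / t over 0 < s < 1, for an
    analytic k, has the Taylor coefficients l! k_l at t = 0, and the truncation
    only contributes flat terms.  From order 2 to order 3 one passes by
    superposing dilations, g being replaced with the sum of the 2^-i g(c i t):
    the n-th derivative at 0 is multiplied by c^n times a moment which lies
    between n! and 2^(n+1) n! ([borel_gevrey3]).  Finally the derivatives at the
    other end are killed by a cutoff function of order 2, which costs nothing in
    the class of order 3, and the two ends are treated separately.  All bounds
    are linear in the size C of the data, so that theta is as small as needed for
    the nonlinear estimate if C is. *)

(** * Derivatives within an interval *)

(** The form without quotients is the one that passes to sums of series. *)
Lemma is_derive_in_eps (a b : R) (f : R -> R) (x l : R) :
  is_derive_in a b f x l <->
  forall eps : R, 0 < eps -> exists delta : R, 0 < delta /\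
    forall z : R, a <= z <= b -> Rabs (z - x) < delta ->
      Rabs (f z - f x - l * (z - x)) <= eps * Rabs (z - x).
Proof.
  split.
  - intros H eps Heps.
    destruct (H eps Heps) as [d [Hd Hz]]; exists d; split; [exact Hd|].
    intros z Hzab Hzd.
    destruct (Req_dec z x) as [->|Hne].
    + replace (f x - f x - l * (x - x)) with 0 by ring.
      replace (x - x) with 0 by ring; rewrite Rabs_R0; lra.
    + assert (Hzx : z - x <> 0) by lra.
      specialize (Hz z); simpl in Hz; unfold D_x, Rdist in Hz.
      assert (Hlt : Rabs ((f z - f x) / (z - x) - l) < eps)
        by (apply Hz; repeat split; try tauto; auto).
      replace (f z - f x - l * (z - x))
        with (((f z - f x) / (z - x) - l) * (z - x)) by (field; auto).
      rewrite Rabs_mult; apply Rmult_le_compat_r; [apply Rabs_pos | lra].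
  - intros H eps Heps.
    destruct (H (eps / 2)) as [d [Hd Hz]]; [lra|].
    exists d; split; [exact Hd|].
    intros z [[Hzab Hne] Hzd]; simpl in Hzd |- *; unfold Rdist in *.
    assert (Hzx : z - x <> 0) by (intro; apply Hne; lra).
    specialize (Hz z Hzab Hzd).
    replace ((f z - f x) / (z - x) - l)
      with ((f z - f x - l * (z - x)) / (z - x)) by (field; auto).
    unfold Rdiv; rewrite Rabs_mult, Rabs_inv.
    assert (Hp : 0 < Rabs (z - x)) by (apply Rabs_pos_lt; auto).
    apply Rle_lt_trans with (eps / 2 * Rabs (z - x) * / Rabs (z - x)).
    + apply Rmult_le_compat_r; [left; apply Rinv_0_lt_compat; exact Hp | exact Hz].
    + rewrite Rmult_assoc, Rinv_r; lra.
Qed.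

Lemma is_derive_in_ext (a b : R) (f g : R -> R) (x l : R) :
  a <= x <= b -> (forall z : R, a <= z <= b -> f z = g z) ->
  is_derive_in a b f x l -> is_derive_in a b g x l.
Proof.
  intros Hx Hfg H; apply is_derive_in_eps; intros eps Heps.
  destruct (proj1 (is_derive_in_eps a b f x l) H eps Heps) as [d [Hd Hz]].
  exists d; split; [exact Hd|]; intros z Hz1 Hz2.
  rewrite <- !Hfg by assumption; auto.
Qed.

Lemma is_derive_in_const (a b c x : R) : is_derive_in a b (fun _ => c) x 0.
Proof. apply Dconst. Qed.

Lemma is_derive_in_id (a b x : R) : is_derive_in a b (fun z => z) x 1.
Proof. exact (Dx _ x). Qed.

Lemma is_derive_in_plus (a b : R) (f g : R -> R) (x l m : R) :
  is_derive_in a b f x l -> is_derive_in a b g x m ->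
  is_derive_in a b (fun z => f z + g z) x (l + m).
Proof. exact (Dadd _ (fun _ => l) (fun _ => m) f g x). Qed.

Lemma is_derive_in_minus (a b : R) (f g : R -> R) (x l m : R) :
  is_derive_in a b f x l -> is_derive_in a b g x m ->
  is_derive_in a b (fun z => f z - g z) x (l - m).
Proof. exact (Dminus _ (fun _ => l) (fun _ => m) f g x). Qed.

Lemma is_derive_in_mult (a b : R) (f g : R -> R) (x l m : R) :
  is_derive_in a b f x l -> is_derive_in a b g x m ->
  is_derive_in a b (fun z => f z * g z) x (l * g x + f x * m).
Proof. exact (Dmult _ (fun _ => l) (fun _ => m) f g x). Qed.

Lemma is_derive_in_scal (a b c : R) (f : R -> R) (x l : R) :
  is_derive_in a b f x l -> is_derive_in a b (fun z => c * f z) x (c * l).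
Proof. exact (Dmult_const _ f (fun _ => l) x c). Qed.

Lemma is_derive_in_affine (a b c d k m : R) (f : R -> R) (x l : R) :
  (forall z : R, a <= z <= b -> c <= k * z + m <= d) ->
  is_derive_in c d f (k * x + m) l ->
  is_derive_in a b (fun z => f (k * z + m)) x (k * l).
Proof.
  intros Hm H; apply is_derive_in_eps; intros eps Heps.
  pose proof (Rabs_pos k) as Hk.
  destruct (proj1 (is_derive_in_eps _ _ _ _ _) H (eps / (Rabs k + 1)))
    as [dl [Hd Hz]]; [apply Rdiv_lt_0_compat; lra|].
  exists (dl / (Rabs k + 1)); split; [apply Rdiv_lt_0_compat; lra|].
  intros z Hzab Hzd.
  assert (Heq : k * z + m - (k * x + m) = k * (z - x)) by ring.
  pose proof (Rabs_pos (z - x)) as Hzx.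
  assert (Hlt : (Rabs k + 1) * Rabs (z - x) < dl).
  { apply (Rmult_lt_compat_l (Rabs k + 1)) in Hzd; [|lra].
    replace ((Rabs k + 1) * (dl / (Rabs k + 1))) with dl in Hzd by (field; lra).
    exact Hzd. }
  specialize (Hz (k * z + m) (Hm z Hzab)).
  rewrite Heq, Rabs_mult in Hz.
  replace (k * l * (z - x)) with (l * (k * (z - x))) by ring.
  apply Rle_trans with (eps / (Rabs k + 1) * (Rabs k * Rabs (z - x))).
  - apply Hz; nra.
  - replace (eps * Rabs (z - x))
      with (eps / (Rabs k + 1) * ((Rabs k + 1) * Rabs (z - x))) by (field; lra).
    apply Rmult_le_compat_l; [|nra].
    apply Rlt_le, Rdiv_lt_0_compat; lra.
Qed.

Lemma is_derive_in_of_is_derive (a b : R) (f : R -> R) (x l : R) :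
  is_derive f x l -> is_derive_in a b f x l.
Proof.
  intros H; apply is_derive_Reals in H.
  apply (D_in_imp f (fun _ => l) no_cond); [intros; exact I|].
  apply (proj2 (derivable_pt_lim_D_in f (fun _ => l) x)); exact H.
Qed.

Lemma is_derive_in_unique (a b : R) (f : R -> R) (x l m : R) :
  a < b -> a <= x <= b ->
  is_derive_in a b f x l -> is_derive_in a b f x m -> l = m.
Proof.
  intros Hab Hx Hl Hm.
  destruct (Req_dec l m) as [|Hne]; [assumption|exfalso].
  assert (He : 0 < Rabs (l - m)) by (apply Rabs_pos_lt; lra).
  destruct (proj1 (is_derive_in_eps _ _ _ _ _) Hl (Rabs (l - m) / 3))
    as [d1 [Hd1 H1]]; [lra|].
  destruct (proj1 (is_derive_in_eps _ _ _ _ _) Hm (Rabs (l - m) / 3))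
    as [d2 [Hd2 H2]]; [lra|].
  assert (Hz : exists z, a <= z <= b /\ 0 < Rabs (z - x) /\
                 Rabs (z - x) < d1 /\ Rabs (z - x) < d2).
  { set (d := Rmin (Rmin d1 d2) (b - a)).
    assert (Hd : 0 < d /\ d <= d1 /\ d <= d2 /\ d <= b - a).
    { unfold d; repeat split.
      - repeat apply Rmin_glb_lt; lra.
      - eapply Rle_trans; [apply Rmin_l|apply Rmin_l].
      - eapply Rle_trans; [apply Rmin_l|apply Rmin_r].
      - apply Rmin_r. }
    destruct (Rle_dec x ((a + b) / 2)).
    - exists (x + d / 2); replace (x + d / 2 - x) with (d / 2) by ring.
      rewrite Rabs_pos_eq; lra.
    - exists (x - d / 2); replace (x - d / 2 - x) with (- (d / 2)) by ring.
      rewrite Rabs_Ropp, Rabs_pos_eq; lra. }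
  destruct Hz as [z [Hz [Hz0 [Hz1 Hz2]]]].
  specialize (H1 z Hz Hz1); specialize (H2 z Hz Hz2).
  assert (H3 : Rabs ((l - m) * (z - x)) <= Rabs (l - m) / 3 * Rabs (z - x)
                 + Rabs (l - m) / 3 * Rabs (z - x)).
  { replace ((l - m) * (z - x)) with
      ((f z - f x - m * (z - x)) - (f z - f x - l * (z - x))) by ring.
    eapply Rle_trans; [apply Rabs_triang|]; rewrite Rabs_Ropp; lra. }
  rewrite Rabs_mult in H3; nra.
Qed.

(** The mean value theorem needs continuity on both sides of the end points, so
    it is applied to the function extended by constants outside the interval. *)
Lemma lipschitz_of_derive_in (a b M : R) (f df : R -> R) :
  (forall x : R, a <= x <= b -> is_derive_in a b f x (df x)) ->
  (forall x : R, a <= x <= b -> Rabs (df x) <= M) ->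
  forall x z : R, a <= x <= b -> a <= z <= b -> Rabs (f z - f x) <= M * Rabs (z - x).
Proof.
  intros Hd HM.
  assert (Hmain : forall x z, a <= x <= b -> a <= z <= b -> x < z ->
            Rabs (f z - f x) <= M * Rabs (z - x)).
  { intros x z Hx Hz Hxz.
    set (cl := fun s => Rmax a (Rmin b s)).
    assert (Hcl : forall s, a <= cl s <= b).
    { intros s; unfold cl; split; [apply Rmax_l|].
      apply Rmax_lub; [lra|apply Rmin_l]. }
    assert (Hid : forall s, a <= s <= b -> cl s = s).
    { intros s Hs; unfold cl; rewrite Rmin_right, Rmax_right; lra. }
    assert (Hlip : forall s t, a <= s <= b -> Rabs (cl t - cl s) <= Rabs (t - s)).
    { intros s t Hs; rewrite (Hid s Hs); unfold cl, Rmax, Rmin, Rabs.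
      repeat destruct Rle_dec; repeat destruct Rcase_abs; lra. }
    destruct (MVT_gen (fun s => f (cl s)) x z df) as [c [Hc Heq]].
    - rewrite Rmin_left, Rmax_right by lra; intros s Hs.
      apply is_derive_Reals.
      intros eps Heps.
      destruct (proj1 (is_derive_in_eps _ _ _ _ _) (Hd s ltac:(lra)) (eps / 2))
        as [d [Hd0 H]]; [lra|].
      assert (Hdd : 0 < Rmin d (Rmin (s - x) (z - s)))
        by (repeat apply Rmin_glb_lt; lra).
      exists (mkposreal _ Hdd); simpl; intros h Hh0 Hh.
      assert (Hh1 : Rabs h < d) by (eapply Rlt_le_trans; [exact Hh|apply Rmin_l]).
      assert (Hh2 : Rabs h < s - x).
      { eapply Rlt_le_trans; [exact Hh|].
        eapply Rle_trans; [apply Rmin_r|apply Rmin_l]. }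
      assert (Hh3 : Rabs h < z - s).
      { eapply Rlt_le_trans; [exact Hh|].
        eapply Rle_trans; [apply Rmin_r|apply Rmin_r]. }
      apply Rabs_def2 in Hh2; apply Rabs_def2 in Hh3.
      rewrite !Hid by lra.
      specialize (H (s + h) ltac:(lra)).
      replace (s + h - s) with h in H by ring; specialize (H Hh1).
      replace ((f (s + h) - f s) / h - df s)
        with ((f (s + h) - f s - df s * h) / h) by (field; auto).
      unfold Rdiv; rewrite Rabs_mult, Rabs_inv.
      assert (Hp : 0 < Rabs h) by (apply Rabs_pos_lt; auto).
      apply Rle_lt_trans with (eps / 2 * Rabs h * / Rabs h).
      + apply Rmult_le_compat_r; [left; apply Rinv_0_lt_compat; exact Hp|exact H].
      + rewrite Rmult_assoc, Rinv_r; lra.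
    - rewrite Rmin_left, Rmax_right by lra; intros s Hs eps Heps.
      destruct (proj1 (is_derive_in_eps _ _ _ _ _) (Hd s ltac:(lra)) 1)
        as [d [Hd0 H]]; [lra|].
      set (L := Rabs (df s) + 2).
      assert (HL : 0 < L) by (unfold L; pose proof (Rabs_pos (df s)); lra).
      exists (Rmin d (eps / L)); split.
      { apply Rmin_glb_lt; [lra|apply Rdiv_lt_0_compat; lra]. }
      intros t [_ Ht]; simpl in Ht |- *; unfold Rdist in *.
      assert (Ht1 : Rabs (t - s) < d) by (eapply Rlt_le_trans; [exact Ht|apply Rmin_l]).
      assert (Ht2 : Rabs (t - s) < eps / L)
        by (eapply Rlt_le_trans; [exact Ht|apply Rmin_r]).
      pose proof (Hlip s t ltac:(lra)) as Hl.
      specialize (H (cl t) (Hcl t)).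
      rewrite (Hid s ltac:(lra)) in Hl |- *.
      specialize (H ltac:(lra)).
      replace (f (cl t) - f s)
        with ((f (cl t) - f s - df s * (cl t - s)) + df s * (cl t - s)) by ring.
      eapply Rle_lt_trans; [apply Rabs_triang|]; rewrite Rabs_mult.
      apply Rle_lt_trans with ((Rabs (df s) + 1) * Rabs (t - s)).
      { pose proof (Rabs_pos (df s)); nra. }
      apply (Rmult_lt_compat_l L) in Ht2; [|lra].
      replace (L * (eps / L)) with eps in Ht2 by (field; lra).
      pose proof (Rabs_pos (t - s)); unfold L in Ht2; nra.
    - rewrite Rmin_left, Rmax_right in Hc by lra.
      rewrite !Hid in Heq by lra.
      rewrite Heq, Rabs_mult; apply Rmult_le_compat_r; [apply Rabs_pos|].
      apply HM; lra. }
  intros x z Hx Hz.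
  destruct (Rtotal_order x z) as [H|[H|H]].
  - auto.
  - subst; replace (f z - f z) with 0 by ring; replace (z - z) with 0 by ring.
    rewrite Rabs_R0; lra.
  - rewrite Rabs_minus_sym, (Rabs_minus_sym z x); auto.
Qed.

Lemma ex_series_bounded (u M : nat -> R) :
  (forall n : nat, Rabs (u n) <= M n) -> ex_series M -> ex_series u.
Proof. exact (ex_series_le u M). Qed.

Lemma Series_bounded (u M : nat -> R) :
  (forall n : nat, Rabs (u n) <= M n) -> ex_series M ->
  Rabs (Series u) <= Series M.
Proof.
  intros H HM; eapply Rle_trans; [apply Series_Rabs|].
  - apply (ex_series_bounded _ M); [intros n; rewrite Rabs_Rabsolu; apply H|exact HM].
  - apply Series_le; [intros n; split; [apply Rabs_pos|apply H]|exact HM].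
Qed.

Lemma is_derive_in_sum (a b : R) (f : nat -> R -> R) (l : nat -> R) (x : R) (n : nat) :
  (forall i : nat, is_derive_in a b (f i) x (l i)) ->
  is_derive_in a b (fun z => sum_f_R0 (fun i => f i z) n) x (sum_f_R0 l n).
Proof.
  intros H; induction n as [|n IH]; simpl; [apply H|].
  apply is_derive_in_plus; [exact IH|apply H].
Qed.

Lemma series_tail_small (M : nat -> R) :
  ex_series M -> forall eps : R, 0 < eps ->
  exists n : nat, (0 < n)%nat /\ Series (fun k => M (n + k)%nat) < eps.
Proof.
  intros [s Hs] eps Heps.
  destruct (Hs (ball s eps)) as [n Hn]; [apply (locally_ball s (mkposreal _ Heps))|].
  exists (S n); split; [lia|].
  assert (He : ex_series M) by (exists s; exact Hs).
  specialize (Hn n (Nat.le_refl _)).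
  rewrite sum_n_Reals in Hn.
  pose proof (Series_incr_n M (S n) ltac:(lia) He) as Hsum.
  rewrite (is_series_unique _ _ Hs) in Hsum; simpl pred in Hsum.
  unfold ball in Hn; simpl in Hn; unfold AbsRing_ball, abs, minus, plus, opp in Hn;
    simpl in Hn.
  apply Rabs_def2 in Hn; lra.
Qed.

(** The remainders of the terms beyond the n-th one are together at most twice
    the tail of the sum of the [M i] times the increment, by the Lipschitz
    bound; the finitely many others are handled one by one. *)
Lemma is_derive_in_series (a b : R) (f df : nat -> R -> R) (M : nat -> R) :
  (forall (n : nat) (x : R), a <= x <= b -> is_derive_in a b (f n) x (df n x)) ->
  (forall (n : nat) (x : R), a <= x <= b -> Rabs (df n x) <= M n) ->
  ex_series M ->
  (forall x : R, a <= x <= b -> ex_series (fun n => f n x)) ->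
  forall x : R, a <= x <= b ->
    is_derive_in a b (fun z => Series (fun n => f n z)) x (Series (fun n => df n x)).
Proof.
  intros Hd HM HsM Hf x Hx.
  apply is_derive_in_eps; intros eps Heps.
  destruct (series_tail_small M HsM (eps / 4)) as [n [Hn0 Hn]]; [lra|].
  destruct (proj1 (is_derive_in_eps _ _ _ _ _)
              (is_derive_in_sum a b f (fun i => df i x) x (pred n)
                 (fun i => Hd i x Hx)) (eps / 2)) as [d [Hd0 H]]; [lra|].
  exists d; split; [exact Hd0|]; intros z Hz Hzd; specialize (H z Hz Hzd).
  assert (Hsdf : ex_series (fun i => df i x))
    by (apply (ex_series_bounded _ M); auto).
  rewrite (Series_incr_n (fun i => f i z) n Hn0 (Hf z Hz)).
  rewrite (Series_incr_n (fun i => f i x) n Hn0 (Hf x Hx)).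
  rewrite (Series_incr_n (fun i => df i x) n Hn0 Hsdf).
  pose proof (proj1 (ex_series_incr_n (fun i => f i z) n) (Hf z Hz)) as Ez.
  pose proof (proj1 (ex_series_incr_n (fun i => f i x) n) (Hf x Hx)) as Ex.
  pose proof (proj1 (ex_series_incr_n (fun i => df i x) n) Hsdf) as Ed.
  pose proof (proj1 (ex_series_incr_n M n) HsM) as EM.
  set (Fz := sum_f_R0 (fun i => f i z) (pred n)) in *.
  set (Fx := sum_f_R0 (fun i => f i x) (pred n)) in *.
  set (D := sum_f_R0 (fun i => df i x) (pred n)) in *.
  assert (Htail : Rabs (Series (fun k => f (n + k)%nat z) - Series (fun k => f (n + k)%nat x)
             - Series (fun k => df (n + k)%nat x) * (z - x))
           <= eps / 4 * 2 * Rabs (z - x)).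
  { rewrite <- Series_minus by assumption.
    rewrite <- Series_scal_r.
    rewrite <- Series_minus;
      [|apply (ex_series_minus (fun k => f (n + k)%nat z)); assumption
       |apply (ex_series_scal_r (z - x)); exact Ed].
    eapply Rle_trans;
      [apply (Series_bounded _ (fun k => M (n + k)%nat * (2 * Rabs (z - x))))|].
    - intros k.
      eapply Rle_trans; [apply Rabs_triang|].
      rewrite Rabs_Ropp, Rabs_mult.
      pose proof (lipschitz_of_derive_in a b (M (n + k)%nat) (f (n + k)%nat) (df (n + k)%nat)
             (Hd _) (HM _) x z Hx Hz).
      pose proof (HM (n + k)%nat x Hx); pose proof (Rabs_pos (z - x)); nra.
    - apply (ex_series_scal_r (2 * Rabs (z - x)) _ EM).
    - rewrite Series_scal_r, Rmult_assoc.
      apply Rmult_le_compat_r; [pose proof (Rabs_pos (z - x)); lra|lra]. }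
  match goal with |- Rabs ?e <= _ =>
    replace e with ((Fz - Fx - D * (z - x)) +
      (Series (fun k => f (n + k)%nat z) - Series (fun k => f (n + k)%nat x)
             - Series (fun k => df (n + k)%nat x) * (z - x))) by ring end.
  eapply Rle_trans; [apply Rabs_triang|]; lra.
Qed.

Lemma derive_in_eq (a b : R) (f : R -> R) (x l : R) :
  a < b -> a <= x <= b -> is_derive_in a b f x l -> derive_in a b f x = l.
Proof.
  intros Hab Hx H; unfold derive_in; apply (iota_unique (V := R_CompleteNormedModule)); [|exact H].
  intros m Hm; exact (is_derive_in_unique a b f x m l Hab Hx Hm H).
Qed.

Definition derivative_chain (a b : R) (F : nat -> R -> R) : Prop :=
  forall (n : nat) (x : R), a <= x <= b -> is_derive_in a b (F n) x (F (S n) x).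

Lemma derive_in_n_chain (a b : R) (F : nat -> R -> R) (f : R -> R) :
  a < b -> derivative_chain a b F -> (forall x : R, a <= x <= b -> f x = F O x) ->
  forall (n : nat) (x : R), a <= x <= b -> derive_in_n a b n f x = F n x.
Proof.
  intros Hab HF Hf n; induction n as [|n IH]; intros x Hx; [apply Hf, Hx|].
  unfold derive_in_n; simpl; apply derive_in_eq; [exact Hab|exact Hx|].
  apply (is_derive_in_ext a b (F n)); [exact Hx| |apply HF, Hx].
  intros z Hz; symmetry; apply IH, Hz.
Qed.

Lemma smooth_in_chain (a b : R) (F : nat -> R -> R) (f : R -> R) :
  a < b -> derivative_chain a b F -> (forall x : R, a <= x <= b -> f x = F O x) ->
  smooth_in a b f.
Proof.
  intros Hab HF Hf n x Hx; exists (F (S n) x).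
  apply (is_derive_in_ext a b (F n)); [exact Hx| |apply HF, Hx].
  intros z Hz; symmetry; apply (derive_in_n_chain a b F); assumption.
Qed.

(** * Leibniz products of jets *)

(** If [f] and [g] list the successive derivatives of two functions at a point,
    then [leib f g] lists those of their product.  The recursion is the Leibniz
    rule itself, which spares all binomial coefficients. *)
Fixpoint leib (f g : nat -> R) (l : nat) : R :=
  match l with
  | O => f O * g O
  | S m => leib (fun j => f (S j)) g m + leib f (fun j => g (S j)) m
  end.

Definition shx (f : nat -> nat -> R) : nat -> nat -> R := fun n l => f (S n) l.
Definition sht (f : nat -> nat -> R) : nat -> nat -> R := fun n l => f n (S l).

(** The same for the jets of two functions of two variables, the entry [n l]
    being the derivative of order n in x and l in t. *)
Fixpoint leib2 (f g : nat -> nat -> R) (n l : nat) : R :=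
  match n with
  | O => leib (f O) (g O) l
  | S m => leib2 (shx f) g m l + leib2 f (shx g) m l
  end.

Definition jet_const (c : R) : nat -> nat -> R :=
  fun n l => match n, l with O, O => c | _, _ => 0 end.

Definition jet_add (f g : nat -> nat -> R) : nat -> nat -> R :=
  fun n l => f n l + g n l.

Lemma leib_ext (f f' g g' : nat -> R) (l : nat) :
  (forall j : nat, f j = f' j) -> (forall j : nat, g j = g' j) ->
  leib f g l = leib f' g' l.
Proof.
  intros Hf Hg; f_equal; apply functional_extensionality; assumption.
Qed.

Lemma leib2_local (f f' g g' : nat -> nat -> R) (n l : nat) :
  (forall i j : nat, (i <= n)%nat -> f i j = f' i j) ->
  (forall i j : nat, (i <= n)%nat -> g i j = g' i j) ->
  leib2 f g n l = leib2 f' g' n l.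
Proof.
  revert f f' g g'; induction n as [|n IH]; intros f f' g g' Hf Hg; simpl.
  - apply leib_ext; intros j; [apply Hf|apply Hg]; lia.
  - f_equal; apply IH; intros i j Hi; unfold shx; (apply Hf || apply Hg); lia.
Qed.

Lemma leib_local (f f' g g' : nat -> R) (l : nat) :
  (forall j : nat, (j <= l)%nat -> f j = f' j) ->
  (forall j : nat, (j <= l)%nat -> g j = g' j) ->
  leib f g l = leib f' g' l.
Proof.
  revert f f' g g'; induction l as [|l IH]; intros f f' g g' Hf Hg; simpl.
  - rewrite Hf, Hg by lia; reflexivity.
  - f_equal; apply IH; intros j Hj; (apply Hf || apply Hg); lia.
Qed.

(** Two truncations are needed, since one recursion below builds jets row by row
    in x and the other one in t. *)
Lemma leib2_local_t (f f' g g' : nat -> nat -> R) (n l : nat) :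
  (forall i j : nat, (j <= l)%nat -> f i j = f' i j) ->
  (forall i j : nat, (j <= l)%nat -> g i j = g' i j) ->
  leib2 f g n l = leib2 f' g' n l.
Proof.
  revert f f' g g'; induction n as [|n IH]; intros f f' g g' Hf Hg; simpl.
  - apply leib_local; intros j Hj; auto.
  - f_equal; apply IH; intros i j Hj; unfold shx; auto.
Qed.

Lemma leib2_t_O (f g : nat -> nat -> R) (n : nat) :
  leib2 f g n 0 = leib (fun i => f i O) (fun i => g i O) n.
Proof.
  revert f g; induction n as [|n IH]; intros f g; simpl; [reflexivity|].
  rewrite !IH; reflexivity.
Qed.

Lemma leib2_t_S (f g : nat -> nat -> R) (n l : nat) :
  leib2 f g n (S l) = leib2 (sht f) g n l + leib2 f (sht g) n l.
Proof.
  revert f g; induction n as [|n IH]; intros f g; simpl; [reflexivity|].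
  rewrite !IH; unfold shx, sht; ring.
Qed.

Lemma leib_comm (f g : nat -> R) (l : nat) : leib f g l = leib g f l.
Proof.
  revert f g; induction l as [|l IH]; intros f g; simpl; [ring|].
  rewrite (IH (fun j => f (S j))), (IH f); ring.
Qed.

Lemma leib_plus_l (f g h : nat -> R) (l : nat) :
  leib (fun j => f j + g j) h l = leib f h l + leib g h l.
Proof.
  revert f g h; induction l as [|l IH]; intros f g h; simpl; [ring|].
  rewrite (IH (fun j => f (S j)) (fun j => g (S j))), (IH f g); ring.
Qed.

Lemma leib_plus_r (f g h : nat -> R) (l : nat) :
  leib f (fun j => g j + h j) l = leib f g l + leib f h l.
Proof. rewrite leib_comm, leib_plus_l, !(leib_comm f); reflexivity. Qed.

Lemma leib_assoc (f g h : nat -> R) (l : nat) :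
  leib (leib f g) h l = leib f (leib g h) l.
Proof.
  revert f g h; induction l as [|l IH]; intros f g h; simpl; [ring|].
  rewrite leib_plus_l, leib_plus_r, !IH; ring.
Qed.

Lemma leib_scal_l (c : R) (f g : nat -> R) (l : nat) :
  leib (fun j => c * f j) g l = c * leib f g l.
Proof.
  revert f g; induction l as [|l IH]; intros f g; simpl; [ring|].
  rewrite (IH (fun j => f (S j))), (IH f); ring.
Qed.

Lemma leib_zero_l (f g : nat -> R) (l : nat) :
  (forall j : nat, f j = 0) -> leib f g l = 0.
Proof.
  intros Hf; rewrite (leib_ext f (fun j => 0 * f j) g g l).
  - rewrite leib_scal_l; ring.
  - intros j; rewrite Hf; ring.
  - reflexivity.
Qed.

Lemma leib_zero_r (f g : nat -> R) (l : nat) :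
  (forall j : nat, g j = 0) -> leib f g l = 0.
Proof. rewrite leib_comm; apply leib_zero_l. Qed.

Lemma leib_unit_r (f g : nat -> R) (l : nat) :
  g O = 1 -> (forall j : nat, g (S j) = 0) -> leib f g l = f l.
Proof.
  intros H0 HS; revert f; induction l as [|l IH]; intros f; simpl.
  - rewrite H0; ring.
  - rewrite IH, leib_zero_r by exact HS; ring.
Qed.

Lemma jet_ext (f g : nat -> nat -> R) : (forall n l : nat, f n l = g n l) -> f = g.
Proof.
  intros H; apply functional_extensionality; intros n.
  apply functional_extensionality; auto.
Qed.

Lemma leib2_comm (f g : nat -> nat -> R) : leib2 f g = leib2 g f.
Proof.
  apply jet_ext; intros n l; revert f g; induction n as [|n IH]; intros f g; simpl.
  - apply leib_comm.
  - rewrite (IH (shx f)), (IH f); ring.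
Qed.

Lemma leib2_add_l (f g h : nat -> nat -> R) :
  leib2 (jet_add f g) h = jet_add (leib2 f h) (leib2 g h).
Proof.
  apply jet_ext; intros n l; revert f g h; unfold jet_add.
  induction n as [|n IH]; intros f g h; simpl.
  - apply leib_plus_l.
  - unfold shx in *; rewrite (IH (fun n l => f (S n) l)), (IH f); ring.
Qed.

Lemma leib2_add_r (f g h : nat -> nat -> R) :
  leib2 f (jet_add g h) = jet_add (leib2 f g) (leib2 f h).
Proof. rewrite leib2_comm, leib2_add_l, !(leib2_comm f); reflexivity. Qed.

Lemma shx_leib2 (f g : nat -> nat -> R) :
  shx (leib2 f g) = jet_add (leib2 (shx f) g) (leib2 f (shx g)).
Proof. apply jet_ext; intros n l; reflexivity. Qed.

Lemma sht_leib2 (f g : nat -> nat -> R) :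
  sht (leib2 f g) = jet_add (leib2 (sht f) g) (leib2 f (sht g)).
Proof. apply jet_ext; intros n l; apply leib2_t_S. Qed.

Lemma leib2_assoc (f g h : nat -> nat -> R) :
  leib2 (leib2 f g) h = leib2 f (leib2 g h).
Proof.
  apply jet_ext; intros n l; revert f g h; induction n as [|n IH]; intros f g h; simpl.
  - apply (leib_assoc (f O) (g O) (h O)).
  - rewrite !shx_leib2, leib2_add_l, leib2_add_r; unfold jet_add.
    rewrite !IH; ring.
Qed.

Lemma leib2_zero_r (f : nat -> nat -> R) : leib2 f (jet_const 0) = jet_const 0.
Proof.
  assert (Hz : forall n l, jet_const 0 n l = 0) by (intros [|n] [|l]; reflexivity).
  assert (Hs : shx (jet_const 0) = jet_const 0)
    by (apply jet_ext; intros n l; unfold shx; rewrite !Hz; reflexivity).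
  apply jet_ext; intros n l; rewrite Hz; revert f.
  induction n as [|n IH]; intros f; simpl.
  - apply leib_zero_r; intros j; apply Hz.
  - rewrite Hs, !IH; ring.
Qed.

Lemma leib2_one_r (f : nat -> nat -> R) : leib2 f (jet_const 1) = f.
Proof.
  apply jet_ext; intros n l; revert f; induction n as [|n IH]; intros f; simpl.
  - apply leib_unit_r; reflexivity.
  - replace (shx (jet_const 1)) with (jet_const 0)
      by (apply jet_ext; intros [|i] [|j]; reflexivity).
    rewrite IH, leib2_zero_r; unfold shx; destruct n, l; simpl; ring.
Qed.

(** ** Majorants of Leibniz products *)

(** The Beta integral of z^p (1 - z)^q over [0, 1]; it is what multiplying the
    majorants (m + p)! and (m + q)! costs. *)
Definition beta (p q : nat) : R :=
  INR (fact p) * INR (fact q) / INR (fact (p + q + 1)).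

Lemma INR_fact_pos (n : nat) : 0 < INR (fact n).
Proof. apply INR_fact_lt_0. Qed.

Lemma INR_fact_S (n : nat) : INR (fact (S n)) = (INR n + 1) * INR (fact n).
Proof. rewrite fact_simpl, mult_INR, S_INR; reflexivity. Qed.

Lemma INR_fact_le (m n : nat) : (m <= n)%nat -> INR (fact m) <= INR (fact n).
Proof. intros H; apply le_INR, fact_le, H. Qed.

Lemma beta_pos (p q : nat) : 0 < beta p q.
Proof.
  apply Rdiv_lt_0_compat; [apply Rmult_lt_0_compat|]; apply INR_fact_pos.
Qed.

Lemma beta_split (p q : nat) : beta p q = beta (S p) q + beta p (S q).
Proof.
  unfold beta; replace (S p + q + 1)%nat with (S (p + q + 1)) by lia.
  replace (p + S q + 1)%nat with (S (p + q + 1)) by lia.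
  rewrite !INR_fact_S, !plus_INR; simpl (INR 1).
  pose proof (INR_fact_pos (p + q + 1)); pose proof (pos_INR p); pose proof (pos_INR q).
  field; split; lra.
Qed.

(** In the expansion of beta (p, q) over the terms beta (p + i, q + 3 - i), with
    binomial coefficients, these are the two extreme terms. *)
Lemma beta_split3 (p q : nat) : beta (p + 3) q + beta p (q + 3) <= beta p q.
Proof.
  replace (p + 3)%nat with (S (S (S p))) by lia.
  replace (q + 3)%nat with (S (S (S q))) by lia.
  rewrite (beta_split p q), (beta_split (S p) q), (beta_split p (S q)).
  rewrite (beta_split (S (S p)) q), (beta_split (S p) (S q)), (beta_split p (S (S q))).
  pose proof (beta_pos (S (S p)) (S q)); pose proof (beta_pos (S p) (S (S q))); lra.
Qed.

(** A derivative in t weighs as three derivatives in x, whence the factorials of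
    [3 * l + p]. *)
Lemma leib_bound (l p q : nat) (A B y : R) (f g : nat -> R) :
  0 <= A -> 0 <= B -> 0 <= y ->
  (forall j : nat, Rabs (f j) <= A * y ^ j * INR (fact (3 * j + p))) ->
  (forall j : nat, Rabs (g j) <= B * y ^ j * INR (fact (3 * j + q))) ->
  Rabs (leib f g l) <= A * B * y ^ l * (beta p q * INR (fact (3 * l + (p + q + 1)))).
Proof.
  revert p q A B f g; induction l as [|l IH]; intros p q A B f g HA HB Hy Hf Hg.
  - simpl leib; specialize (Hf O); specialize (Hg O).
    rewrite Rabs_mult; simpl pow in *; simpl Nat.add in *; simpl Nat.mul in *.
    unfold beta; pose proof (INR_fact_pos (p + q + 1)).
    replace (A * B * 1 * (INR (fact p) * INR (fact q) / INR (fact (p + q + 1)) *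
        INR (fact (p + q + 1))))
      with ((A * 1 * INR (fact p)) * (B * 1 * INR (fact q))) by (field; lra).
    apply Rmult_le_compat; try apply Rabs_pos; assumption.
  - simpl leib.
    eapply Rle_trans; [apply Rabs_triang|].
    assert (H1 : Rabs (leib (fun j => f (S j)) g l) <=
      A * y * B * y ^ l * (beta (p + 3) q * INR (fact (3 * l + (p + 3 + q + 1))))).
    { apply IH; auto; [apply Rmult_le_pos; auto|]; intros j.
      eapply Rle_trans; [apply Hf|].
      replace (3 * S j + p)%nat with (3 * j + (p + 3))%nat by lia; simpl pow; lra. }
    assert (H2 : Rabs (leib f (fun j => g (S j)) l) <=
      A * (B * y) * y ^ l * (beta p (q + 3) * INR (fact (3 * l + (p + (q + 3) + 1))))).
    { apply IH; auto; [apply Rmult_le_pos; auto|]; intros j.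
      eapply Rle_trans; [apply Hg|].
      replace (3 * S j + q)%nat with (3 * j + (q + 3))%nat by lia; simpl pow; lra. }
    replace (3 * l + (p + 3 + q + 1))%nat with (3 * S l + (p + q + 1))%nat in H1 by lia.
    replace (3 * l + (p + (q + 3) + 1))%nat with (3 * S l + (p + q + 1))%nat in H2 by lia.
    set (F := INR (fact (3 * S l + (p + q + 1)))) in *.
    assert (HP : 0 <= A * B * y ^ S l * F).
    { unfold F; repeat apply Rmult_le_pos; auto; [apply pow_le; auto|].
      left; apply INR_fact_pos. }
    pose proof (beta_split3 p q).
    simpl pow in *; nra.
Qed.

Lemma leib2_bound (n l p q : nat) (A B x y : R) (f g : nat -> nat -> R) :
  0 <= A -> 0 <= B -> 0 <= x -> 0 <= y ->
  (forall i j : nat, (i <= n)%nat ->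
     Rabs (f i j) <= A * x ^ i * y ^ j * INR (fact (i + 3 * j + p))) ->
  (forall i j : nat, (i <= n)%nat ->
     Rabs (g i j) <= B * x ^ i * y ^ j * INR (fact (i + 3 * j + q))) ->
  Rabs (leib2 f g n l) <=
    A * B * x ^ n * y ^ l * (beta p q * INR (fact (n + 3 * l + (p + q + 1)))).
Proof.
  revert p q A B f g; induction n as [|n IH]; intros p q A B f g HA HB Hx Hy Hf Hg.
  - simpl leib2.
    eapply Rle_trans; [apply (leib_bound l p q A B y); auto|].
    + intros j; eapply Rle_trans; [apply (Hf O j); lia|]; simpl pow; right.
      rewrite Nat.add_0_l; ring.
    + intros j; eapply Rle_trans; [apply (Hg O j); lia|]; simpl pow; right.
      rewrite Nat.add_0_l; ring.
    + rewrite Nat.add_0_l; simpl pow; right; ring.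
  - simpl leib2.
    eapply Rle_trans; [apply Rabs_triang|].
    assert (H1 : Rabs (leib2 (shx f) g n l) <=
      A * x * B * x ^ n * y ^ l * (beta (S p) q * INR (fact (n + 3 * l + (S p + q + 1))))).
    { apply IH; auto; [apply Rmult_le_pos; auto|]; intros i j Hi; unfold shx.
      eapply Rle_trans; [apply Hf; lia|].
      replace (S i + 3 * j + p)%nat with (i + 3 * j + S p)%nat by lia; simpl pow.
      right; ring. }
    assert (H2 : Rabs (leib2 f (shx g) n l) <=
      A * (B * x) * x ^ n * y ^ l * (beta p (S q) * INR (fact (n + 3 * l + (p + S q + 1))))).
    { apply IH; auto; [apply Rmult_le_pos; auto|]; intros i j Hi; unfold shx.
      eapply Rle_trans; [apply Hg; lia|].
      replace (S i + 3 * j + q)%nat with (i + 3 * j + S q)%nat by lia; simpl pow.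
      right; ring. }
    replace (n + 3 * l + (S p + q + 1))%nat with (S n + 3 * l + (p + q + 1))%nat in H1 by lia.
    replace (n + 3 * l + (p + S q + 1))%nat with (S n + 3 * l + (p + q + 1))%nat in H2 by lia.
    rewrite (beta_split p q); simpl pow; lra.
Qed.

Lemma is_derive_in_leib (a b t : R) (F G : R -> nat -> R) (l : nat) :
  (forall j : nat, is_derive_in a b (fun s => F s j) t (F t (S j))) ->
  (forall j : nat, is_derive_in a b (fun s => G s j) t (G t (S j))) ->
  is_derive_in a b (fun s => leib (F s) (G s) l) t (leib (F t) (G t) (S l)).
Proof.
  revert F G; induction l as [|l IH]; intros F G HF HG.
  - exact (is_derive_in_mult a b (fun s => F s O) (fun s => G s O) t _ _ (HF O) (HG O)).
  - apply is_derive_in_plus.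
    + exact (IH (fun s j => F s (S j)) G (fun j => HF (S j)) HG).
    + exact (IH F (fun s j => G s (S j)) HF (fun j => HG (S j))).
Qed.

Lemma is_derive_in_leib2 (a b t : R) (F G : R -> nat -> nat -> R) (n l : nat) :
  (forall i j : nat, (i <= n)%nat -> is_derive_in a b (fun s => F s i j) t (F t i (S j))) ->
  (forall i j : nat, (i <= n)%nat -> is_derive_in a b (fun s => G s i j) t (G t i (S j))) ->
  is_derive_in a b (fun s => leib2 (F s) (G s) n l) t (leib2 (F t) (G t) n (S l)).
Proof.
  revert F G; induction n as [|n IH]; intros F G HF HG.
  - apply (is_derive_in_leib a b t (fun s => F s O) (fun s => G s O)); intros j;
      [apply HF|apply HG]; lia.
  - apply is_derive_in_plus.
    + apply (IH (fun s => shx (F s)) G); intros i j Hi; [apply HF|apply HG]; lia.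
    + apply (IH F (fun s => shx (G s))); intros i j Hi; [apply HF|apply HG]; lia.
Qed.

(** * Jets of solutions of the equation *)

(** The jet of y_xxx + y_x + y y_x. *)
Definition kdv (f : nat -> nat -> R) : nat -> nat -> R :=
  fun n l => f (S (S (S n))) l + f (S n) l + leib2 f (shx f) n l.

(** ** Recursion by rows *)

Fixpoint rows_upto (step : (nat -> nat -> R) -> nat -> nat -> R) (n : nat)
  : nat -> nat -> R :=
  match n with
  | O => fun _ _ => 0
  | S m => fun i => if Nat.eqb i m then step (rows_upto step m) m
                    else rows_upto step m i
  end.

Definition rows (step : (nat -> nat -> R) -> nat -> nat -> R) : nat -> nat -> R :=
  fun n => step (rows_upto step n) n.

(** Rows are functions, so that instead of structural recursion each row is
    computed from a table of the previous ones, which suffices when [step] reads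
    nothing else. *)
Lemma rows_eq (step : (nat -> nat -> R) -> nat -> nat -> R) :
  (forall (f g : nat -> nat -> R) (n l : nat),
     (forall i j : nat, (i < n)%nat -> f i j = g i j) -> step f n l = step g n l) ->
  forall n l : nat, rows step n l = step (rows step) n l.
Proof.
  intros Hloc n l; unfold rows at 1; apply Hloc.
  clear l; induction n as [|n IH]; intros i j Hi; [lia|]; simpl.
  destruct (Nat.eqb_spec i n) as [->|Hne]; [reflexivity|]; apply IH; lia.
Qed.

(** ** The jet determined by the values at t = 0 *)

Definition transpose (f : nat -> nat -> R) : nat -> nat -> R := fun n l => f l n.

Definition tstep (alpha : nat -> R) (v : nat -> nat -> R) (l n : nat) : R :=
  match l with
  | O => alpha n
  | S m => kdv (transpose v) n m
  end.

Definition tjet (alpha : nat -> R) : nat -> nat -> R := transpose (rows (tstep alpha)).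

Lemma tstep_rows (alpha : nat -> R) (l n : nat) :
  rows (tstep alpha) l n = tstep alpha (rows (tstep alpha)) l n.
Proof.
  apply rows_eq; clear l n; intros f g [|l] n H; [reflexivity|].
  unfold tstep, kdv, transpose; rewrite !(H l) by lia; f_equal.
  apply leib2_local_t; intros i j Hj; unfold shx; apply H; lia.
Qed.

Lemma tjet_O (alpha : nat -> R) (n : nat) : tjet alpha n 0 = alpha n.
Proof. unfold tjet, transpose; rewrite tstep_rows; reflexivity. Qed.

Lemma tjet_S (alpha : nat -> R) (n l : nat) :
  tjet alpha n (S l) = kdv (tjet alpha) n l.
Proof. unfold tjet, transpose; rewrite tstep_rows; reflexivity. Qed.

Lemma INR_fact_plus2_ge (m : nat) :
  (2 <= m)%nat -> INR (fact m) <= INR (fact (m + 2)) / 12.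
Proof.
  intros Hm; apply (le_INR 2) in Hm; simpl in Hm.
  replace (m + 2)%nat with (S (S m)) by lia; rewrite !INR_fact_S, S_INR.
  pose proof (INR_fact_pos m) as Hf.
  assert (H : 12 <= (INR m + 1 + 1) * (INR m + 1)) by nra.
  apply (Rmult_le_compat_r (INR (fact m))) in H; lra.
Qed.

(** Since the data have radius of convergence 12, they are dominated with
    [x = 1/12]; the factor [y] per derivative in t has to exceed
    x^3 + x/12 + A x/12, the three terms coming from y_xxx, y_x and y y_x. *)
Lemma tjet_bound (alpha : nat -> R) (A : R) :
  0 <= A <= / 12 ->
  (forall n : nat, Rabs (alpha n) <= A * INR (fact n) / 12 ^ n) ->
  forall l n : nat,
    Rabs (tjet alpha n l) <= A * (/ 12) ^ n * (7 / 864) ^ l * INR (fact (n + 3 * l + 1)).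
Proof.
  intros HA Ha l; induction l as [l IH] using lt_wf_ind; intros n.
  destruct l as [|l].
  - rewrite tjet_O; eapply Rle_trans; [apply Ha|].
    rewrite pow_inv; unfold Rdiv; simpl pow.
    pose proof (INR_fact_le n (n + 3 * 0 + 1) ltac:(lia)).
    assert (0 < / 12 ^ n) by (apply Rinv_0_lt_compat, pow_lt; lra).
    assert (0 <= A * / 12 ^ n) by (apply Rmult_le_pos; lra); nra.
  - rewrite tjet_S; unfold kdv.
    set (u := tjet alpha) in *.
    (* The induction bounds only the entries with at most l derivatives in t. *)
    set (v := fun i j => if Nat.leb j l then u i j else 0).
    assert (Hv : forall i j,
      Rabs (v i j) <= A * (/ 12) ^ i * (7 / 864) ^ j * INR (fact (i + 3 * j + 1))).
    { intros i j; unfold v; destruct (Nat.leb_spec j l).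
      - apply IH; lia.
      - rewrite Rabs_R0; repeat apply Rmult_le_pos; try (apply pow_le; lra); [lra|].
        left; apply INR_fact_pos. }
    assert (H3 : Rabs (leib2 u (shx u) n l) <=
       A * (A * / 12) * (/ 12) ^ n * (7 / 864) ^ l *
         (beta 1 2 * INR (fact (n + 3 * l + (1 + 2 + 1))))).
    { rewrite (leib2_local_t u v (shx u) (shx v)).
      - apply leib2_bound; try lra.
        + intros i j _; apply Hv.
        + intros i j _; unfold shx; eapply Rle_trans; [apply Hv|].
          replace (S i + 3 * j + 1)%nat with (i + 3 * j + 2)%nat by lia; simpl pow.
          right; ring.
      - intros i j Hj; unfold v; destruct (Nat.leb_spec j l); [reflexivity|lia].
      - intros i j Hj; unfold v, shx; destruct (Nat.leb_spec j l); [reflexivity|lia]. }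
    pose proof (IH l ltac:(lia) (S (S (S n)))) as H1.
    pose proof (IH l ltac:(lia) (S n)) as H2.
    replace (beta 1 2) with (/ 12) in H3 by (unfold beta; simpl; field).
    replace (n + 3 * l + (1 + 2 + 1))%nat with (n + 3 * S l + 1)%nat in H3 by lia.
    replace (S (S (S n)) + 3 * l + 1)%nat with (n + 3 * S l + 1)%nat in H1 by lia.
    assert (HF : INR (fact (S n + 3 * l + 1)) <= INR (fact (n + 3 * S l + 1)) / 12).
    { replace (n + 3 * S l + 1)%nat with ((S n + 3 * l + 1) + 2)%nat by lia.
      apply INR_fact_plus2_ge; lia. }
    set (F := INR (fact (n + 3 * S l + 1))) in *.
    set (P := A * (/ 12) ^ n * (7 / 864) ^ l) in *.
    assert (HP : 0 <= P)
      by (unfold P; repeat apply Rmult_le_pos; try (apply pow_le; lra); lra).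
    assert (HF0 : 0 < F) by apply INR_fact_pos.
    eapply Rle_trans; [apply Rabs_triang|].
    eapply Rle_trans; [apply Rplus_le_compat_r, Rabs_triang|].
    assert (H1' : Rabs (u (S (S (S n))) l) <= P * F / 1728).
    { eapply Rle_trans; [exact H1|]; unfold P; simpl pow; right; field. }
    assert (H2' : Rabs (u (S n) l) <= P * F / 144).
    { eapply Rle_trans; [exact H2|].
      replace (A * (/ 12) ^ S n * (7 / 864) ^ l) with (P / 12)
        by (unfold P; simpl pow; field).
      replace (P * F / 144) with (P / 12 * (F / 12)) by field.
      apply Rmult_le_compat_l; [lra|exact HF]. }
    assert (H3' : Rabs (leib2 u (shx u) n l) <= P * F * (A / 144)).
    { eapply Rle_trans; [exact H3|]; unfold P; right; field. }
    replace (A * (/ 12) ^ n * (7 / 864) ^ S l * F) with (P * F * (7 / 864))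
      by (unfold P; simpl pow; ring).
    assert (0 <= P * F) by (apply Rmult_le_pos; lra).
    nra.
Qed.

(** ** The jet determined by the values at x = 0 *)

(** The values of y, y_x and y_xx at x = 0 are 0, 0 and the jet [th]. *)
Definition xstep (th : nat -> R) (f : nat -> nat -> R) (n l : nat) : R :=
  match n with
  | O | S O => 0
  | S (S O) => th l
  | S (S (S m)) => f m (S l) - f (S m) l - leib2 f (shx f) m l
  end.

Definition xjet (th : nat -> R) : nat -> nat -> R := rows (xstep th).

Lemma xjet_eq (th : nat -> R) (n l : nat) : xjet th n l = xstep th (xjet th) n l.
Proof.
  apply rows_eq; clear n l; intros f g [|[|[|n]]] l H; try reflexivity.
  simpl; rewrite (H n), (H (S n)) by lia; f_equal.
  apply leib2_local; intros i j Hi; unfold shx; apply H; lia.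
Qed.

Lemma xjet_unique (th : nat -> R) (f : nat -> nat -> R) :
  (forall l : nat, f 0%nat l = 0) -> (forall l : nat, f 1%nat l = 0) ->
  (forall l : nat, f 2%nat l = th l) -> (forall n l : nat, f n (S l) = kdv f n l) ->
  forall n l : nat, xjet th n l = f n l.
Proof.
  intros H0 H1 H2 Hk n; induction n as [n IH] using lt_wf_ind; intros l.
  rewrite xjet_eq; destruct n as [|[|[|n]]]; unfold xstep; try (symmetry; auto; fail).
  rewrite !IH by lia; rewrite (leib2_local _ f _ (shx f)).
  - specialize (Hk n l); unfold kdv in Hk; lra.
  - intros i j Hi; apply IH; lia.
  - intros i j Hi; unfold shx; apply IH; lia.
Qed.

(** Three derivatives in x now cost [x^3], which has to exceed
    y + x/12 + A x/12. *)
Lemma xjet_bound (th : nat -> R) (A : R) :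
  0 <= A <= / 4 ->
  (forall l : nat, Rabs (th l) <= A * (19 / 20) ^ 2 * (3 / 4) ^ l * INR (fact (3 * l + 3))) ->
  forall n l : nat,
    Rabs (xjet th n l) <= A * (19 / 20) ^ n * (3 / 4) ^ l * INR (fact (n + 3 * l + 1)).
Proof.
  intros HA Hth n; induction n as [n IH] using lt_wf_ind; intros l.
  assert (Hpos : forall m k p, 0 <= A * (19 / 20) ^ m * (3 / 4) ^ k * INR (fact p)).
  { intros m k p; repeat apply Rmult_le_pos; try (apply pow_le; lra); [lra|].
    left; apply INR_fact_pos. }
  rewrite xjet_eq; destruct n as [|[|[|n]]].
  - simpl xstep; rewrite Rabs_R0; apply Hpos.
  - simpl xstep; rewrite Rabs_R0; apply Hpos.
  - unfold xstep; replace (2 + 3 * l + 1)%nat with (3 * l + 3)%nat by lia; apply Hth.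
  - unfold xstep; set (u := xjet th) in *.
    assert (H3 : Rabs (leib2 u (shx u) n l) <=
       A * (A * (19 / 20)) * (19 / 20) ^ n * (3 / 4) ^ l *
         (beta 1 2 * INR (fact (n + 3 * l + (1 + 2 + 1))))).
    { apply leib2_bound; try lra.
      - intros i j Hi; apply IH; lia.
      - intros i j Hi; unfold shx; eapply Rle_trans; [apply IH; lia|].
        replace (S i + 3 * j + 1)%nat with (i + 3 * j + 2)%nat by lia; simpl pow.
        right; ring. }
    pose proof (IH n ltac:(lia) (S l)) as H1.
    pose proof (IH (S n) ltac:(lia) l) as H2.
    replace (beta 1 2) with (/ 12) in H3 by (unfold beta; simpl; field).
    replace (n + 3 * l + (1 + 2 + 1))%nat with (S (S (S n)) + 3 * l + 1)%nat in H3 by lia.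
    replace (n + 3 * S l + 1)%nat with (S (S (S n)) + 3 * l + 1)%nat in H1 by lia.
    assert (HF : INR (fact (S n + 3 * l + 1)) <= INR (fact (S (S (S n)) + 3 * l + 1)) / 12).
    { replace (S (S (S n)) + 3 * l + 1)%nat with ((S n + 3 * l + 1) + 2)%nat by lia.
      apply INR_fact_plus2_ge; lia. }
    set (F := INR (fact (S (S (S n)) + 3 * l + 1))) in *.
    set (P := A * (19 / 20) ^ n * (3 / 4) ^ l) in *.
    assert (HP : 0 <= P)
      by (unfold P; repeat apply Rmult_le_pos; try (apply pow_le; lra); lra).
    assert (HF0 : 0 < F) by apply INR_fact_pos.
    unfold Rminus.
    eapply Rle_trans; [apply Rabs_triang|].
    eapply Rle_trans; [apply Rplus_le_compat_r, Rabs_triang|].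
    rewrite !Rabs_Ropp.
    assert (H1' : Rabs (u n (S l)) <= P * F * (3 / 4)).
    { eapply Rle_trans; [exact H1|]; unfold P; simpl pow; right; field. }
    assert (H2' : Rabs (u (S n) l) <= P * F * (19 / 240)).
    { eapply Rle_trans; [exact H2|].
      replace (A * (19 / 20) ^ S n * (3 / 4) ^ l) with (P * (19 / 20))
        by (unfold P; simpl pow; field).
      replace (P * F * (19 / 240)) with (P * (19 / 20) * (F / 12)) by field.
      apply Rmult_le_compat_l; [lra|exact HF]. }
    assert (H3' : Rabs (leib2 u (shx u) n l) <= P * F * (A * (19 / 240))).
    { eapply Rle_trans; [exact H3|]; unfold P; right; field. }
    replace (A * (19 / 20) ^ S (S (S n)) * (3 / 4) ^ l * F)
      with (P * F * (19 / 20) ^ 3) by (unfold P; simpl pow; ring).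
    assert (0 <= P * F) by (apply Rmult_le_pos; lra).
    simpl pow; nra.
Qed.

(** The jet along x = 0 at a time t: differentiating it in t shifts it, since the
    recursion is compatible with the Leibniz rule in t. *)
Lemma is_derive_in_xjet (a b t : R) (th : R -> nat -> R) :
  (forall l : nat, is_derive_in a b (fun s => th s l) t (th t (S l))) ->
  forall n l : nat,
    is_derive_in a b (fun s => xjet (th s) n l) t (xjet (th t) n (S l)).
Proof.
  intros Hth n; induction n as [n IH] using lt_wf_ind; intros l.
  rewrite xjet_eq.
  replace (fun s => xjet (th s) n l) with (fun s => xstep (th s) (xjet (th s)) n l)
    by (apply functional_extensionality; intros s; symmetry; apply xjet_eq).
  destruct n as [|[|[|n]]]; unfold xstep.
  - apply is_derive_in_const.
  - apply is_derive_in_const.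
  - apply Hth.
  - apply is_derive_in_minus; [apply is_derive_in_minus|].
    + apply IH; lia.
    + apply IH; lia.
    + apply (is_derive_in_leib2 a b t (fun s => xjet (th s)) (fun s => shx (xjet (th s))));
        intros i j Hi; unfold shx; apply IH; lia.
Qed.

(** ** The compatibility conditions *)

(** Polynomials in y, y_x, y_xx, ... are read as jets instead of numbers: the
    operators D_x and D_t then become the two shifts, as soon as the jet
    substituted for y solves the equation. *)
Fixpoint jpoly_jet (u : nat -> nat -> R) (G : jpoly) : nat -> nat -> R :=
  match G with
  | JConst c => jet_const c
  | JVar i => fun n l => u (i + n)%nat l
  | JAdd G H => jet_add (jpoly_jet u G) (jpoly_jet u H)
  | JMul G H => leib2 (jpoly_jet u G) (jpoly_jet u H)
  end.

Lemma jpoly_jet_eval (u : nat -> nat -> R) (G : jpoly) :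
  jpoly_jet u G 0%nat 0%nat = jeval (fun i => u i 0%nat) G.
Proof.
  induction G as [c|i|G IHG H IHH|G IHG H IHH]; simpl.
  - reflexivity.
  - rewrite Nat.add_0_r; reflexivity.
  - unfold jet_add; rewrite IHG, IHH; reflexivity.
  - rewrite IHG, IHH; reflexivity.
Qed.

Lemma jet_const_0 (n l : nat) : jet_const 0 n l = 0.
Proof. destruct n, l; reflexivity. Qed.

Lemma jet_add_0_r (f : nat -> nat -> R) : jet_add f (jet_const 0) = f.
Proof. apply jet_ext; intros n l; unfold jet_add; rewrite jet_const_0; ring. Qed.

Lemma jet_add_0_l (f : nat -> nat -> R) : jet_add (jet_const 0) f = f.
Proof. apply jet_ext; intros n l; unfold jet_add; rewrite jet_const_0; ring. Qed.

Lemma jet_add_swap (f g h k : nat -> nat -> R) :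
  jet_add (jet_add f g) (jet_add h k) = jet_add (jet_add f h) (jet_add g k).
Proof. apply jet_ext; intros n l; unfold jet_add; ring. Qed.

(** Any derivation [D] of jets satisfies the chain rule D G = sum_i W_i dG/dy_i
    on polynomials, if W_i represents the derivative of the i-th variable; [w] is
    allowed to exceed the width, as the width of a sum is that of its larger
    term. *)
Section ChainRule.

Variable u : nat -> nat -> R.
Variable D : (nat -> nat -> R) -> nat -> nat -> R.
Hypothesis D_const : forall c : R, D (jet_const c) = jet_const 0.
Hypothesis D_add : forall f g : nat -> nat -> R, D (jet_add f g) = jet_add (D f) (D g).
Hypothesis D_leib2 : forall f g : nat -> nat -> R,
  D (leib2 f g) = jet_add (leib2 (D f) g) (leib2 f (D g)).

Variable W : nat -> jpoly.
Hypothesis D_var : forall i : nat, jpoly_jet u (W i) = D (jpoly_jet u (JVar i)).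

Let dsum (w : nat) (G : jpoly) : nat -> nat -> R :=
  jpoly_jet u (jsum w (fun i => JMul (W i) (jpartial i G))).

Lemma jet_chain_rule (G : jpoly) (w : nat) :
  (jwidth G <= w)%nat -> dsum w G = D (jpoly_jet u G).
Proof.
  revert w; induction G as [c|j|G IHG H IHH|G IHG H IHH]; intros w Hw.
  - simpl; rewrite D_const.
    clear Hw; induction w as [|w IH]; [reflexivity|].
    unfold dsum in *; simpl in *; rewrite IH, leib2_zero_r, jet_add_0_r; reflexivity.
  - simpl in Hw; rewrite <- D_var.
    assert (Hlow : forall k, (k <= j)%nat -> dsum k (JVar j) = jet_const 0).
    { intros k; induction k as [|k IH]; intros Hk; [reflexivity|].
      unfold dsum in *; simpl in *; rewrite IH by lia.
      destruct (Nat.eqb_spec k j); [lia|].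
      rewrite leib2_zero_r, jet_add_0_r; reflexivity. }
    induction w as [|w IH]; [lia|].
    unfold dsum in *; simpl in *.
    destruct (Nat.eqb_spec w j) as [->|Hne].
    + rewrite Hlow, leib2_one_r, jet_add_0_l by lia; reflexivity.
    + rewrite IH, leib2_zero_r, jet_add_0_r by lia; reflexivity.
  - simpl in Hw; simpl jpoly_jet; rewrite D_add, <- (IHG w), <- (IHH w) by lia.
    clear Hw; induction w as [|w IH]; [symmetry; apply jet_add_0_l|].
    unfold dsum in *; simpl in *; rewrite IH, leib2_add_r, jet_add_swap; reflexivity.
  - simpl in Hw; simpl jpoly_jet; rewrite D_leib2, <- (IHG w), <- (IHH w) by lia.
    clear Hw; induction w as [|w IH].
    + unfold dsum; simpl.
      rewrite (leib2_comm (jet_const 0)), !leib2_zero_r, jet_add_0_l; reflexivity.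
    + unfold dsum in *; simpl in *; rewrite IH, leib2_add_r, leib2_add_l, leib2_add_r.
      rewrite jet_add_swap; f_equal; f_equal; [symmetry; apply leib2_assoc|].
      rewrite <- !leib2_assoc, (leib2_comm (jpoly_jet u (W w))); reflexivity.
Qed.

End ChainRule.

Section Compatibility.

Variable u : nat -> nat -> R.
Hypothesis u_kdv : forall n l : nat, u n (S l) = kdv u n l.

Lemma jpoly_jet_Dx (G : jpoly) : jpoly_jet u (jDx G) = shx (jpoly_jet u G).
Proof.
  apply (jet_chain_rule u shx) with (W := fun i => JVar (S i)); try lia.
  - intros c; apply jet_ext; intros [|n] [|l]; reflexivity.
  - intros f g; reflexivity.
  - exact shx_leib2.
  - intros i; apply jet_ext; intros n l; unfold shx; simpl.
    rewrite Nat.add_succ_r; reflexivity.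
Qed.

Lemma jpoly_jet_Dx_iter (i : nat) (G : jpoly) (n l : nat) :
  jpoly_jet u (Nat.iter i jDx G) n l = jpoly_jet u G (i + n)%nat l.
Proof.
  revert n; induction i as [|i IH]; intros n; [reflexivity|].
  simpl Nat.iter; rewrite jpoly_jet_Dx; unfold shx; rewrite IH.
  f_equal; lia.
Qed.

(** Here the equation enters: it says that D_x^i of the right-hand side
    represents the derivative in t of the i-th variable. *)
Lemma jpoly_jet_Dt (G : jpoly) : jpoly_jet u (jDt G) = sht (jpoly_jet u G).
Proof.
  apply (jet_chain_rule u sht) with (W := fun i => Nat.iter i jDx jkdv); try lia.
  - intros c; apply jet_ext; intros [|n] [|l]; reflexivity.
  - intros f g; reflexivity.
  - exact sht_leib2.
  - intros i; apply jet_ext; intros n l.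
    rewrite jpoly_jet_Dx_iter; unfold sht; simpl jpoly_jet; rewrite u_kdv; reflexivity.
Qed.

Lemma jpoly_jet_Dt_iter (k : nat) (G : jpoly) (n l : nat) :
  jpoly_jet u (Nat.iter k jDt G) n l = jpoly_jet u G n (k + l)%nat.
Proof.
  revert l; induction k as [|k IH]; intros l; [reflexivity|].
  simpl Nat.iter; rewrite jpoly_jet_Dt; unfold sht; rewrite IH.
  f_equal; lia.
Qed.

Lemma jeval_J1 (l : nat) : jeval (fun i => u i 0%nat) (J1 l) = u 0%nat l.
Proof.
  rewrite <- jpoly_jet_eval; unfold J1; rewrite jpoly_jet_Dt_iter, Nat.add_0_r.
  reflexivity.
Qed.

Lemma jeval_J2 (l : nat) : jeval (fun i => u i 0%nat) (J2 l) = u 1%nat l.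
Proof.
  rewrite <- jpoly_jet_eval; unfold J2; rewrite jpoly_jet_Dt_iter, Nat.add_0_r.
  reflexivity.
Qed.

End Compatibility.

(** The jet generated by compatible initial data solves the recursion in x with
    vanishing first two rows, and that recursion has only one solution. *)
Lemma tjet_eq_xjet (alpha : nat -> R) :
  (forall l : nat, jeval alpha (J1 l) = 0 /\ jeval alpha (J2 l) = 0) ->
  forall n l : nat, xjet (tjet alpha 2) n l = tjet alpha n l.
Proof.
  intros Hc.
  assert (Ha : (fun i => tjet alpha i 0%nat) = alpha)
    by (apply functional_extensionality, tjet_O).
  pose proof (jeval_J1 (tjet alpha) (tjet_S alpha)) as HJ1.
  pose proof (jeval_J2 (tjet alpha) (tjet_S alpha)) as HJ2.
  rewrite Ha in HJ1, HJ2.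
  apply xjet_unique.
  - intros l; rewrite <- HJ1; apply Hc.
  - intros l; rewrite <- HJ2; apply Hc.
  - reflexivity.
  - apply tjet_S.
Qed.

(** * A Borel theorem in the Gevrey class of order 3 *)

(** ** Sums of factorials against geometric sequences *)

(** The product (l + 1) ... (l + p). *)
Definition rise (p l : nat) : R := INR (fact (l + p)) / INR (fact l).

Lemma rise_O (l : nat) : rise 0 l = 1.
Proof.
  unfold rise; rewrite Nat.add_0_r; pose proof (INR_fact_pos l); field; lra.
Qed.

Lemma rise_S (p l : nat) : rise (S p) l = (INR l + INR p + 1) * rise p l.
Proof.
  unfold rise; rewrite Nat.add_succ_r, INR_fact_S, plus_INR.
  pose proof (INR_fact_pos l); field; lra.
Qed.

Lemma rise_shift (p l : nat) : (INR l + 1) * rise p (S l) = rise (S p) l.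
Proof.
  unfold rise; rewrite INR_fact_S, Nat.add_succ_r, Nat.add_succ_l.
  pose proof (INR_fact_pos l); pose proof (pos_INR l); field; lra.
Qed.

Lemma rise_pos (p l : nat) : 0 < rise p l.
Proof. apply Rdiv_lt_0_compat; apply INR_fact_pos. Qed.

Lemma sum_rise (p n : nat) :
  (INR p + 1) * sum_f_R0 (rise p) n = rise (S p) n.
Proof.
  induction n as [|n IH]; simpl sum_f_R0.
  - rewrite rise_S; simpl (INR 0); ring.
  - rewrite Rmult_plus_distr_l, IH, <- rise_shift, rise_S, !S_INR; ring.
Qed.

(** The derivatives of the geometric series, by Cauchy products with it. *)
Lemma is_series_rise (p : nat) (z : R) :
  0 <= z < 1 ->
  is_series (fun l => rise p l * z ^ l) (INR (fact p) / (1 - z) ^ S p).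
Proof.
  intros Hz; induction p as [|p IH].
  - apply (is_series_ext (fun l => z ^ l)); [intros l; rewrite rise_O, Rmult_1_l; reflexivity|].
    assert (E : INR (fact 0) / (1 - z) ^ 1 = / (1 - z)) by (simpl; field; lra).
    rewrite E.
    apply is_series_geom; rewrite Rabs_pos_eq; lra.
  - assert (Hg : is_series (fun l => z ^ l) (/ (1 - z)))
      by (apply is_series_geom; rewrite Rabs_pos_eq; lra).
    assert (Hm : is_series (fun n => sum_f_R0 (fun k => rise p k * z ^ k * z ^ (n - k)) n)
                   (INR (fact p) / (1 - z) ^ S p * / (1 - z))).
    { apply (is_series_mult_pos (fun k => rise p k * z ^ k) (fun k => z ^ k));
        [exact IH|exact Hg| |].
      - intros n; apply Rmult_le_pos; [left; apply rise_pos|apply pow_le; lra].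
      - intros n; apply pow_le; lra. }
    apply (is_series_scal_r (INR p + 1)) in Hm.
    assert (E : INR (fact (S p)) / (1 - z) ^ S (S p)
      = INR (fact p) / (1 - z) ^ S p * / (1 - z) * (INR p + 1)).
    { rewrite INR_fact_S; simpl pow.
      field; repeat split; try apply pow_nonzero; lra. }
    rewrite E; eapply is_series_ext; [|exact Hm]; intros n; simpl.
    rewrite (sum_eq _ (fun k => rise p k * z ^ n)).
    + rewrite <- scal_sum, <- sum_rise; ring.
    + intros i Hi; rewrite Rmult_assoc, <- pow_add; do 2 f_equal; lia.
Qed.

Lemma ex_series_rise (p : nat) : ex_series (fun l => rise p l * (/ 2) ^ l).
Proof. eexists; apply is_series_rise; lra. Qed.

Lemma ex_series_rise_scal (N : R) (p : nat) :
  ex_series (fun l => N * (rise p l * (/ 2) ^ l)).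
Proof. exact (ex_series_scal_l N _ (ex_series_rise p)). Qed.

Lemma Series_rise (p : nat) :
  Series (fun l => rise p l * (/ 2) ^ l) = INR (fact p) * 2 ^ S p.
Proof.
  rewrite (is_series_unique _ _ (is_series_rise p (/ 2) ltac:(lra))).
  replace (1 - / 2) with (/ 2) by field; rewrite pow_inv; field.
  apply pow_nonzero; lra.
Qed.

Lemma is_series_term_le (a : nat -> R) (s : R) (n : nat) :
  (forall k : nat, 0 <= a k) -> is_series a s -> a n <= s.
Proof.
  intros Ha Hs.
  apply Rle_trans with (sum_n a n).
  - destruct n as [|n]; [rewrite sum_O; lra|rewrite sum_Sn].
    assert (0 <= sum_n a n) by (rewrite sum_n_Reals; apply cond_pos_sum; auto).
    unfold plus; simpl; lra.
  - apply (is_lim_seq_incr_compare (sum_n a)); [exact Hs|].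
    intros k; rewrite sum_Sn; unfold plus; simpl; specialize (Ha (S k)); lra.
Qed.

(** ** The moments of the weights 2^-k at the integers *)

Definition moment (n : nat) : R := Series (fun k => (/ 2) ^ k * INR k ^ n).

Lemma pow_le_rise (k n : nat) : INR k ^ n <= rise n k.
Proof.
  induction n as [|n IH]; [rewrite rise_O; simpl; lra|].
  rewrite rise_S; simpl pow.
  pose proof (pos_INR k); pose proof (pos_INR n).
  apply Rmult_le_compat; [lra|apply pow_le; lra|lra|exact IH].
Qed.

Lemma rise_le_pow (k n m : nat) : (n <= m)%nat -> rise n k <= INR (m + k) ^ n.
Proof.
  induction n as [|n IH]; intros Hn; [rewrite rise_O; simpl; lra|].
  rewrite rise_S; simpl pow; rewrite plus_INR in *.
  pose proof (pos_INR k); pose proof (pos_INR n).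
  apply le_INR in Hn as Hn'; rewrite S_INR in Hn'.
  apply Rmult_le_compat; [lra|left; apply rise_pos|lra|apply IH; lia].
Qed.

Lemma moment_term (k n : nat) :
  0 <= (/ 2) ^ k * INR k ^ n <= rise n k * (/ 2) ^ k.
Proof.
  assert (H : 0 < (/ 2) ^ k) by (apply pow_lt; lra).
  pose proof (pow_le_rise k n).
  assert (0 <= INR k ^ n) by (apply pow_le, pos_INR).
  split; [apply Rmult_le_pos; lra|nra].
Qed.

Lemma ex_series_moment (n : nat) : ex_series (fun k => (/ 2) ^ k * INR k ^ n).
Proof.
  apply (ex_series_bounded _ (fun k => rise n k * (/ 2) ^ k)).
  - intros k; rewrite Rabs_pos_eq; apply moment_term.
  - apply ex_series_rise.
Qed.

Lemma moment_le (n : nat) : moment n <= INR (fact n) * 2 ^ S n.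
Proof.
  rewrite <- Series_rise; apply Series_le; [intros k; apply moment_term|].
  apply ex_series_rise.
Qed.

(** The terms of index at least n are minorised by the falling factorials of the
    index, which have an explicit sum. *)
Lemma moment_ge (n : nat) : INR (fact n) <= moment n.
Proof.
  destruct n as [|n].
  - apply Rle_trans with ((/ 2) ^ 0 * INR 0 ^ 0); [simpl; lra|].
    apply (is_series_term_le (fun k => (/ 2) ^ k * INR k ^ 0)).
    + intros k; apply moment_term.
    + apply Series_correct, ex_series_moment.
  - set (m := S n).
    unfold moment; rewrite (Series_incr_n _ m ltac:(lia) (ex_series_moment m)).
    assert (H0 : 0 <= sum_f_R0 (fun k => (/ 2) ^ k * INR k ^ m) (pred m))
      by (apply cond_pos_sum; intros k; apply moment_term).
    assert (H1 : Series (fun k => (/ 2) ^ m * (rise m k * (/ 2) ^ k)) <=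
                 Series (fun k => (/ 2) ^ (m + k) * INR (m + k) ^ m)).
    { apply Series_le.
      - intros k; rewrite pow_add.
        assert (0 < (/ 2) ^ k) by (apply pow_lt; lra).
        assert (0 < (/ 2) ^ m) by (apply pow_lt; lra).
        pose proof (rise_pos m k).
        pose proof (rise_le_pow k m m (Nat.le_refl _)).
        split; [apply Rmult_le_pos; [lra|]; apply Rmult_le_pos; lra|].
        rewrite Rmult_assoc; apply Rmult_le_compat_l; [lra|].
        rewrite (Rmult_comm (rise m k)); apply Rmult_le_compat_l; lra.
      - apply (ex_series_incr_n (fun k => (/ 2) ^ k * INR k ^ m) m), ex_series_moment. }
    rewrite Series_scal_l, Series_rise in H1.
    replace ((/ 2) ^ m * (INR (fact m) * 2 ^ S m)) with (2 * INR (fact m)) in H1.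
    + pose proof (INR_fact_pos m); lra.
    + rewrite pow_inv; simpl pow; field; apply pow_nonzero; lra.
Qed.

(** ** Flat functions *)

(** [flat q] is t^-q exp (- 1 / t), extended by 0. *)
Definition flat (q : nat) (t : R) : R :=
  if Rlt_dec 0 t then exp (- / t) * (/ t) ^ q else 0.

(** The m-th derivative of [flat q]. *)
Fixpoint dflat (m q : nat) (t : R) : R :=
  match m with
  | O => flat q t
  | S k => dflat k (S (S q)) t - INR q * dflat k (S q) t
  end.

Lemma flat_nonpos (q : nat) (t : R) : t <= 0 -> flat q t = 0.
Proof. intros H; unfold flat; destruct (Rlt_dec 0 t); [lra|reflexivity]. Qed.

Lemma flat_0 (q : nat) : flat q 0 = 0.
Proof. apply flat_nonpos; lra. Qed.

Lemma flat_S (q : nat) (t : R) : t * flat (S q) t = flat q t.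
Proof.
  unfold flat; destruct (Rlt_dec 0 t); [simpl; field; lra|ring].
Qed.

Lemma pow_le_exp (x : R) (q : nat) : 0 <= x -> x ^ q <= INR (fact q) * exp x.
Proof.
  intros Hx; pose proof (INR_fact_pos q) as Hf.
  assert (H : x ^ q / INR (fact q) <= exp x).
  { eapply Rle_trans; [|apply (exp_ge_taylor x q Hx)].
    destruct q as [|q]; [right; reflexivity|rewrite tech5].
    assert (0 <= sum_f_R0 (fun k => x ^ k / INR (fact k)) q); [|lra].
    apply cond_pos_sum; intros k.
    apply Rmult_le_pos; [apply pow_le; lra|left; apply Rinv_0_lt_compat, INR_fact_pos]. }
  apply (Rmult_le_compat_l (INR (fact q))) in H; [|lra].
  replace (INR (fact q) * (x ^ q / INR (fact q))) with (x ^ q) in H by (field; lra).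
  exact H.
Qed.

(** With x = 1/t this is x^q / q! <= exp x. *)
Lemma flat_bounds (q : nat) (t : R) : 0 <= flat q t <= INR (fact q).
Proof.
  pose proof (INR_fact_pos q); unfold flat; destruct (Rlt_dec 0 t) as [Ht|]; [|lra].
  assert (Hi : 0 < / t) by (apply Rinv_0_lt_compat; exact Ht).
  pose proof (exp_pos (- / t)); pose proof (pow_le_exp (/ t) q ltac:(lra)) as Hp.
  split; [apply Rmult_le_pos; [lra|apply pow_le; lra]|].
  apply (Rmult_le_compat_l (exp (- / t))) in Hp; [|lra].
  eapply Rle_trans; [exact Hp|].
  rewrite exp_Ropp; right; field; apply Rgt_not_eq, exp_pos.
Qed.

Lemma is_derive_flat (q : nat) (t : R) : 0 < t ->
  is_derive (flat q) t (flat (S (S q)) t - INR q * flat (S q) t).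
Proof.
  intros Ht.
  apply (is_derive_ext_loc (fun s => exp (- / s) * (/ s) ^ q)).
  - apply (filter_imp (fun s => 0 < s)); [|apply (open_gt 0 t Ht)].
    intros s Hs; unfold flat; destruct (Rlt_dec 0 s); [reflexivity|lra].
  - unfold flat; destruct (Rlt_dec 0 t) as [_|]; [|lra].
    auto_derive; [lra|].
    destruct q as [|q]; simpl pred; simpl pow; [simpl (INR 0)|]; field; lra.
Qed.

Lemma is_derive_in_flat (q : nat) (a t : R) : 0 <= t <= a ->
  is_derive_in 0 a (flat q) t (flat (S (S q)) t - INR q * flat (S q) t).
Proof.
  intros Ht; destruct (Req_dec t 0) as [->|Hne].
  - rewrite !flat_0; apply is_derive_in_eps; intros eps Heps.
    pose proof (INR_fact_pos (S (S q))) as Hf.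
    exists (eps / INR (fact (S (S q)))); split; [apply Rdiv_lt_0_compat; lra|].
    intros z Hz Hd; rewrite flat_0.
    replace (z - 0) with z in * by ring.
    replace (flat q z - 0 - (0 - INR q * 0) * z) with (flat q z) by ring.
    rewrite (Rabs_pos_eq z) in * by lra.
    rewrite <- flat_S, <- (flat_S (S q)).
    pose proof (flat_bounds (S (S q)) z) as Hb.
    rewrite Rabs_pos_eq by (repeat apply Rmult_le_pos; lra).
    apply (Rmult_lt_compat_l (INR (fact (S (S q))))) in Hd; [|lra].
    replace (INR (fact (S (S q))) * (eps / INR (fact (S (S q))))) with eps in Hd
      by (field; lra).
    rewrite (Rmult_comm eps); apply Rmult_le_compat_l; [lra|].
    rewrite Rmult_comm; apply Rle_trans with (INR (fact (S (S q))) * z); [|lra].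
    apply Rmult_le_compat_r; lra.
  - apply is_derive_in_of_is_derive, is_derive_flat; lra.
Qed.

Lemma dflat_chain (q : nat) (a : R) : derivative_chain 0 a (fun m => dflat m q).
Proof.
  intros m; revert q; induction m as [|m IH]; intros q t Ht.
  - apply is_derive_in_flat, Ht.
  - apply (is_derive_in_minus 0 a (dflat m (S (S q))) (fun s => INR q * dflat m (S q) s)).
    + apply IH, Ht.
    + apply is_derive_in_scal, IH, Ht.
Qed.

Lemma dflat_0 (m q : nat) : dflat m q 0 = 0.
Proof.
  revert q; induction m as [|m IH]; intros q; simpl; [apply flat_0|].
  rewrite !IH; ring.
Qed.

(** The two terms of the recursion are in the proportion of 1 to at most
    q / (q + 2 m + 2), whence the factor 2 per derivative. *)
Lemma dflat_bound (m q : nat) (t : R) :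
  Rabs (dflat m q t) <= 2 ^ m * INR (fact (q + 2 * m)).
Proof.
  revert q; induction m as [|m IH]; intros q.
  - simpl dflat; rewrite Rabs_pos_eq by apply flat_bounds.
    simpl pow; rewrite Rmult_1_l; replace (q + 2 * 0)%nat with q by lia.
    apply flat_bounds.
  - simpl dflat; eapply Rle_trans; [apply Rabs_triang|].
    rewrite Rabs_Ropp, Rabs_mult, (Rabs_pos_eq (INR q)) by apply pos_INR.
    pose proof (IH (S (S q))) as H1; pose proof (IH (S q)) as H2.
    replace (S (S q) + 2 * m)%nat with (q + 2 * S m)%nat in H1 by lia.
    replace (q + 2 * S m)%nat with (S (S q + 2 * m))%nat in * by lia.
    rewrite INR_fact_S in *; set (F := INR (fact (S q + 2 * m))) in *.
    assert (HF : 0 < F) by apply INR_fact_pos.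
    assert (Hq : INR q <= INR (S q + 2 * m)) by (apply le_INR; lia).
    assert (Hp : 0 < 2 ^ m) by (apply pow_lt; lra).
    pose proof (pos_INR q).
    apply (Rmult_le_compat_l (INR q)) in H2; [|lra].
    assert (INR q * (2 ^ m * F) <= (INR (S q + 2 * m) + 1) * (2 ^ m * F)).
    { apply Rmult_le_compat_r; [apply Rmult_le_pos; lra|lra]. }
    simpl pow; lra.
Qed.

(** ** Truncated Laplace transforms *)

(** For t > 0 this is the integral of s^l exp (- s / t) / t over [0, 1], that is
    l! t^l but for an exponentially small error. *)
Fixpoint psi (l : nat) (t : R) : R :=
  match l with
  | O => 1 - flat 0 t
  | S m => INR (S m) * t * psi m t - flat 0 t
  end.

Lemma psi_S (l : nat) (t : R) : psi (S l) t = INR (S l) * t * psi l t - flat 0 t.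
Proof. reflexivity. Qed.

(** The derivative of [psi l]. *)
Definition dpsi (l : nat) (t : R) : R :=
  INR l ^ 2 * psi (pred l) t - INR l * flat 1 t - flat 2 t.

Lemma is_derive_in_psi (l : nat) (a t : R) :
  0 <= t <= a -> is_derive_in 0 a (psi l) t (dpsi l t).
Proof.
  intros Ht; pose proof (is_derive_in_flat 0 a t Ht) as Hf.
  induction l as [|l IH].
  - replace (dpsi 0 t) with (0 - (flat 2 t - INR 0 * flat 1 t))
      by (unfold dpsi; simpl; ring).
    apply (is_derive_in_minus 0 a (fun _ => 1)); [apply is_derive_in_const|exact Hf].
  - replace (dpsi (S l) t) with
      ((INR (S l) * 1 * psi l t + INR (S l) * t * dpsi l t)
         - (flat 2 t - INR 0 * flat 1 t)).
    + apply (is_derive_in_minus 0 a (fun s => INR (S l) * s * psi l s));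
        [apply (is_derive_in_mult 0 a (fun s => INR (S l) * s))|exact Hf].
      * apply is_derive_in_scal, is_derive_in_id.
      * exact IH.
    + unfold dpsi; simpl pred.
      replace (INR (S l) * t * (INR l ^ 2 * psi (pred l) t - INR l * flat 1 t - flat 2 t))
        with (INR (S l) * (INR l * (INR l * t * psi (pred l) t) - INR l * (t * flat 1 t)
                - t * flat 2 t)) by ring.
      rewrite !flat_S.
      replace (INR l * (INR l * t * psi (pred l) t))
        with (INR l * (psi l t + flat 0 t))
        by (destruct l as [|l]; [simpl; ring|simpl pred; rewrite psi_S; ring]).
      rewrite S_INR; simpl (INR 0); ring.
Qed.

Definition exp_sum (l : nat) (x : R) : R := sum_f_R0 (fun k => x ^ k / INR (fact k)) l.

Lemma is_derive_exp_sum (l : nat) (x : R) : is_derive (exp_sum (S l)) x (exp_sum l x).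
Proof.
  assert (Hpow : forall k, is_derive (fun x => x ^ S k / INR (fact (S k))) x
                   (x ^ k / INR (fact k))).
  { intros k; auto_derive; [exact I|].
    change (fact k + k * fact k)%nat with (fact (S k)); rewrite INR_fact_S; pose proof (INR_fact_pos k); pose proof (pos_INR k).
    replace (match k with 0%nat => 1 | S _ => INR k + 1 end) with (INR k + 1)
      by (destruct k; simpl; lra).
    field; split; lra. }
  induction l as [|l IH].
  - apply (is_derive_ext (fun x => 1 + x ^ 1 / INR (fact 1))).
    + intros s; unfold exp_sum; simpl; field.
    + replace (exp_sum 0 x) with (0 + x ^ 0 / INR (fact 0)) by (unfold exp_sum; simpl; ring).
      apply (is_derive_plus (fun _ : R => 1)); [apply (is_derive_const (V := R_NormedModule))|].
      apply Hpow.
  - apply (is_derive_plus (exp_sum (S l))); [exact IH|apply Hpow].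
Qed.

(** Both sides vanish at 0 for l > 0, and their derivatives are compared by the
    inequality for l - 1. *)
Lemma exp_remainder (l : nat) (x : R) :
  0 <= x -> exp x - exp_sum l x <= exp x * x ^ l / INR (fact l).
Proof.
  revert x; induction l as [|l IH]; intros x Hx.
  - unfold exp_sum; simpl; lra.
  - set (D := fun x => exp x * x ^ S l / INR (fact (S l)) - exp x + exp_sum (S l) x).
    set (D' := fun x => exp x * x ^ S l / INR (fact (S l))
                 + (exp x * x ^ l / INR (fact l) - exp x + exp_sum l x)).
    assert (HD : forall s, is_derive D s (D' s)).
    { intros s; unfold D, D'.
      replace (exp s * s ^ S l / INR (fact (S l)) +
         (exp s * s ^ l / INR (fact l) - exp s + exp_sum l s)) with
        ((exp s * s ^ S l / INR (fact (S l)) + exp s * s ^ l / INR (fact l) - exp s)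
          + exp_sum l s) by ring.
      apply (is_derive_plus (fun x => exp x * x ^ S l / INR (fact (S l)) - exp x));
        [|apply is_derive_exp_sum].
      auto_derive; [exact I|].
      change (fact l + l * fact l)%nat with (fact (S l)); rewrite INR_fact_S; pose proof (INR_fact_pos l); pose proof (pos_INR l).
      replace (match l with 0%nat => 1 | S _ => INR l + 1 end) with (INR l + 1)
        by (destruct l; simpl; lra).
      simpl pow; field; split; lra. }
    assert (HD0 : D 0 = 0).
    { unfold D; rewrite exp_0; replace (exp_sum (S l) 0) with 1; [simpl; unfold Rdiv; ring|].
      clear; unfold exp_sum; symmetry; induction (S l) as [|k IH];
        [simpl; field|simpl sum_f_R0; rewrite IH; simpl; unfold Rdiv; ring]. }
    destruct (MVT_gen D 0 x D') as [c [Hc Heq]].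
    + intros s _; apply HD.
    + intros s _; apply continuity_pt_filterlim, (ex_derive_continuous D).
      eexists; apply HD.
    + rewrite Rmin_left, Rmax_right in Hc by lra.
      assert (HD' : 0 <= D' c).
      { unfold D'; specialize (IH c ltac:(lra)).
        assert (0 <= exp c * c ^ S l / INR (fact (S l))); [|lra].
        apply Rmult_le_pos; [apply Rmult_le_pos|].
        - left; apply exp_pos.
        - apply pow_le; lra.
        - left; apply Rinv_0_lt_compat, INR_fact_pos. }
      rewrite HD0 in Heq; assert (0 <= D x) by nra; unfold D in *; lra.
Qed.

Lemma psi_closed_form (l : nat) (t : R) : 0 < t ->
  psi l t = INR (fact l) * t ^ l * (exp (- / t) * (exp (/ t) - exp_sum l (/ t))).
Proof.
  intros Ht.
  assert (He : exp (- / t) * exp (/ t) = 1)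
    by (rewrite <- exp_plus, Rplus_opp_l; apply exp_0).
  assert (Hf : flat 0 t = exp (- / t))
    by (unfold flat; destruct (Rlt_dec 0 t); [simpl; ring|lra]).
  induction l as [|l IH].
  - simpl psi; rewrite Hf; unfold exp_sum; simpl; rewrite Rmult_minus_distr_l, He; field.
  - rewrite psi_S, IH, Hf; unfold exp_sum; rewrite tech5, INR_fact_S, S_INR.
    pose proof (INR_fact_pos l); pose proof (pos_INR l).
    rewrite pow_inv; simpl pow; field.
    repeat split; try lra; apply pow_nonzero; lra.
Qed.

(** The integral of s^l exp (- s / t) / t over [0, 1] is at most the one for
    l = 0, that is 1 - exp (- 1 / t).  The closed form gives the bound by 1
    without the integral. *)
Lemma psi_bounds (l : nat) (t : R) : 0 <= t -> 0 <= psi l t <= 1.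
Proof.
  intros Ht; destruct (Req_dec t 0) as [->|Hne].
  - destruct l as [|l]; [simpl psi|rewrite psi_S]; rewrite flat_0; [lra|].
    rewrite Rmult_0_r, Rmult_0_l; lra.
  - assert (Hi : 0 < / t) by (apply Rinv_0_lt_compat; lra).
    rewrite psi_closed_form by lra.
    pose proof (exp_ge_taylor (/ t) l ltac:(lra)) as H1; fold (exp_sum l (/ t)) in H1.
    pose proof (exp_remainder l (/ t) ltac:(lra)) as H2.
    pose proof (exp_pos (- / t)) as He; pose proof (INR_fact_pos l) as Hf.
    assert (Hp : 0 < t ^ l) by (apply pow_lt; lra).
    split; [repeat apply Rmult_le_pos; lra|].
    apply Rle_trans with (INR (fact l) * t ^ l *
      (exp (- / t) * (exp (/ t) * (/ t) ^ l / INR (fact l)))).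
    + repeat apply Rmult_le_compat_l; try lra; apply Rmult_le_pos; lra.
    + rewrite pow_inv, exp_Ropp; right; field.
      repeat split; try lra; apply Rgt_not_eq, exp_pos.
Qed.

Lemma psi_0 (l : nat) : psi (S l) 0 = 0.
Proof. rewrite psi_S, flat_0; ring. Qed.

Lemma dpsi_bound (l : nat) (t : R) : 0 <= t -> Rabs (dpsi l t) <= rise 2 l.
Proof.
  intros Ht; unfold dpsi.
  pose proof (psi_bounds (pred l) t Ht) as Hp.
  pose proof (flat_bounds 1 t) as H1; pose proof (flat_bounds 2 t) as H2.
  pose proof (pos_INR l) as Hl.
  rewrite !rise_S, rise_O; simpl INR in *; simpl pow in *.
  assert (0 <= INR l * (INR l * 1) * psi (pred l) t <= INR l * INR l).
  { assert (0 <= INR l * INR l) by nra; split; [apply Rmult_le_pos|]; nra. }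
  assert (0 <= INR l * flat 1 t <= INR l) by (split; nra).
  apply Rabs_le; split; nra.
Qed.

(** ** Superpositions of truncated Laplace transforms *)

(** The truncated Laplace transform of the analytic function with Taylor
    coefficients [k]. *)
Definition lap (k : nat -> R) (t : R) : R := Series (fun l => k l * psi l t).

(** The coefficients of the derivative, apart from flat terms. *)
Definition lap_shift (k : nat -> R) : nat -> R := fun l => (INR l + 1) ^ 2 * k (S l).

(** The n-th derivative of [lap k]. *)
Fixpoint dlap (n : nat) (k : nat -> R) (t : R) : R :=
  match n with
  | O => lap k t
  | S m => dlap m (lap_shift k) t - Series (fun l => INR l * k l) * dflat m 1 t
             - Series k * dflat m 2 t
  end.

(** The growth of the coefficients of the j-th derivative. *)
Definition lap_coef (j : nat) (N : R) (k : nat -> R) : Prop :=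
  forall l : nat, Rabs (k l) <= N * (rise (2 * j) l * (/ 2) ^ l).

Lemma lap_coef_nonneg (j : nat) (N : R) (k : nat -> R) : lap_coef j N k -> 0 <= N.
Proof.
  intros H; specialize (H O); pose proof (Rabs_pos (k O)); pose proof (rise_pos (2 * j) 0).
  simpl pow in H; nra.
Qed.

Lemma lap_coef_weight (j : nat) (N : R) (k c : nat -> R) (p : nat) :
  lap_coef j N k -> (forall l : nat, Rabs (c l) * rise (2 * j) l <= rise p l) ->
  forall l : nat, Rabs (c l * k l) <= N * (rise p l * (/ 2) ^ l).
Proof.
  intros Hk Hc l; rewrite Rabs_mult.
  pose proof (lap_coef_nonneg _ _ _ Hk) as HN.
  assert (Hp : 0 < (/ 2) ^ l) by (apply pow_lt; lra).
  apply Rle_trans with (Rabs (c l) * (N * (rise (2 * j) l * (/ 2) ^ l))).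
  - apply Rmult_le_compat_l; [apply Rabs_pos|apply Hk].
  - replace (Rabs (c l) * (N * (rise (2 * j) l * (/ 2) ^ l)))
      with (N * (Rabs (c l) * rise (2 * j) l * (/ 2) ^ l)) by ring.
    apply Rmult_le_compat_l; [lra|]; apply Rmult_le_compat_r; [lra|apply Hc].
Qed.

Lemma Series_rise_bound (N : R) (u : nat -> R) (p : nat) :
  (forall l : nat, Rabs (u l) <= N * (rise p l * (/ 2) ^ l)) ->
  ex_series u /\ Rabs (Series u) <= N * (INR (fact p) * 2 ^ S p).
Proof.
  intros H; split.
  - apply (ex_series_bounded _ _ H (ex_series_rise_scal N p)).
  - rewrite <- Series_rise, <- Series_scal_l.
    apply (Series_bounded _ _ H (ex_series_rise_scal N p)).
Qed.

Lemma lap_weight_psi (j : nat) (N t : R) (k : nat -> R) : 0 <= t -> lap_coef j N k ->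
  forall l : nat, Rabs (k l * psi l t) <= N * (rise (2 * j) l * (/ 2) ^ l).
Proof.
  intros Ht Hk l; rewrite Rmult_comm; revert l.
  apply (lap_coef_weight j); [exact Hk|]; intros l.
  pose proof (psi_bounds l t Ht); pose proof (rise_pos (2 * j) l).
  rewrite Rabs_pos_eq by lra; nra.
Qed.

Lemma lap_weight_INR (j : nat) (N : R) (k : nat -> R) : lap_coef j N k ->
  forall l : nat, Rabs (INR l * k l) <= N * (rise (S (2 * j)) l * (/ 2) ^ l).
Proof.
  intros Hk; apply (lap_coef_weight j); [exact Hk|]; intros l.
  rewrite Rabs_pos_eq, rise_S by apply pos_INR.
  apply Rmult_le_compat_r; [left; apply rise_pos|].
  pose proof (pos_INR (2 * j)); lra.
Qed.

Lemma lap_coef_shift (j : nat) (N : R) (k : nat -> R) :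
  lap_coef j N k -> lap_coef (S j) (N / 2) (lap_shift k).
Proof.
  intros Hk l; unfold lap_shift.
  pose proof (lap_coef_nonneg _ _ _ Hk) as HN; pose proof (pos_INR l) as Hl.
  rewrite Rabs_mult, Rabs_pos_eq by (apply pow_le; lra).
  eapply Rle_trans; [apply Rmult_le_compat_l; [apply pow_le; lra|apply Hk]|].
  assert (Hr : (INR l + 1) ^ 2 * rise (2 * j) (S l) <= rise (2 * S j) l).
  { replace ((INR l + 1) ^ 2 * rise (2 * j) (S l))
      with ((INR l + 1) * ((INR l + 1) * rise (2 * j) (S l))) by ring.
    replace (2 * S j)%nat with (S (S (2 * j))) by lia.
    rewrite rise_shift, (rise_S (S (2 * j))); apply Rmult_le_compat_r;
      [left; apply rise_pos|].
    pose proof (pos_INR (S (2 * j))); lra. }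
  assert (Hp : 0 < (/ 2) ^ l) by (apply pow_lt; lra).
  replace ((INR l + 1) ^ 2 * (N * (rise (2 * j) (S l) * (/ 2) ^ S l)))
    with (N / 2 * (((INR l + 1) ^ 2 * rise (2 * j) (S l)) * (/ 2) ^ l)) by (simpl pow; field).
  apply Rmult_le_compat_l; [lra|]; apply Rmult_le_compat_r; lra.
Qed.

Lemma is_derive_in_lap (j : nat) (N a t : R) (k : nat -> R) :
  lap_coef j N k -> 0 <= t <= a -> is_derive_in 0 a (lap k) t (dlap 1 k t).
Proof.
  intros Hk Ht.
  replace (dlap 1 k t) with (Series (fun l => k l * dpsi l t)).
  - apply (is_derive_in_series 0 a (fun l t => k l * psi l t) (fun l t => k l * dpsi l t)
             (fun l => N * (rise (2 * S j) l * (/ 2) ^ l))); [| | | |exact Ht].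
    + intros l s Hs; apply is_derive_in_scal, is_derive_in_psi, Hs.
    + intros l s Hs; rewrite Rmult_comm; revert l.
      apply (lap_coef_weight j); [exact Hk|]; intros l.
      apply Rle_trans with (rise 2 l * rise (2 * j) l).
      * apply Rmult_le_compat_r; [left; apply rise_pos|apply dpsi_bound; lra].
      * replace (2 * S j)%nat with (S (S (2 * j))) by lia; rewrite !rise_S, rise_O.
        pose proof (rise_pos (2 * j) l); pose proof (pos_INR l); pose proof (pos_INR (2 * j)).
        rewrite (S_INR (2 * j)), (S_INR 0), <- (Rmult_assoc _ _ (rise (2 * j) l)).
        simpl (INR 0); apply Rmult_le_compat_r; [lra|nra].
    + apply ex_series_rise_scal.
    + intros s Hs; eapply Series_rise_bound, (lap_weight_psi j N s k); [lra|exact Hk].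
  - destruct (Series_rise_bound _ _ _ (lap_weight_INR j N k Hk)) as [E1 _].
    destruct (Series_rise_bound N k (2 * j) Hk) as [E0 _].
    destruct (Series_rise_bound _ _ _
       (lap_weight_psi _ _ t _ (proj1 Ht) (lap_coef_shift j N k Hk))) as [E2 _].
    assert (E2' : ex_series (fun l => k l * (INR l ^ 2 * psi (pred l) t))).
    { apply ex_series_incr_1; eapply ex_series_ext; [|exact E2].
      intros l; simpl pred; unfold lap_shift; rewrite S_INR; simpl; ring. }
    simpl dlap; unfold lap.
    replace (Series (fun l => lap_shift k l * psi l t))
      with (Series (fun l => k l * (INR l ^ 2 * psi (pred l) t))).
    + assert (E1' : ex_series (fun l => INR l * k l * flat 1 t))
        by exact (ex_series_scal_r (flat 1 t) _ E1).
      assert (E0' : ex_series (fun l => k l * flat 2 t))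
        by exact (ex_series_scal_r (flat 2 t) _ E0).
      assert (E21 : ex_series (fun l => k l * (INR l ^ 2 * psi (pred l) t)
                                          - INR l * k l * flat 1 t))
        by exact (ex_series_minus _ _ E2' E1').
      rewrite <- !Series_scal_r, <- !Series_minus by assumption.
      apply Series_ext; intros l; unfold dpsi; ring.
    + rewrite Series_incr_1 by exact E2'.
      simpl (INR 0); rewrite pow_i, Rmult_0_l, Rmult_0_r, Rplus_0_l by lia.
      apply Series_ext; intros l; simpl pred; unfold lap_shift; rewrite S_INR; ring.
Qed.

Lemma dlap_chain (j : nat) (N a : R) (k : nat -> R) :
  lap_coef j N k -> derivative_chain 0 a (fun n => dlap n k).
Proof.
  intros Hk n; revert j N k Hk; induction n as [|n IH]; intros j N k Hk t Ht.
  - exact (is_derive_in_lap j N a t k Hk Ht).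
  - apply (is_derive_in_minus 0 a
      (fun s => dlap n (lap_shift k) s - Series (fun l => INR l * k l) * dflat n 1 s)).
    + apply (is_derive_in_minus 0 a (dlap n (lap_shift k))).
      * exact (IH _ _ _ (lap_coef_shift j N k Hk) t Ht).
      * apply is_derive_in_scal, dflat_chain, Ht.
    + apply is_derive_in_scal, dflat_chain, Ht.
Qed.

Lemma dlap_0 (n : nat) (k : nat -> R) : dlap n k 0 = INR (fact n) ^ 2 * k n.
Proof.
  revert k; induction n as [|n IH]; intros k.
  - simpl dlap; unfold lap.
    assert (Hz : forall l, 0 * (rise 0 l * (/ 2) ^ l) = k (S l) * psi (S l) 0)
      by (intros l; rewrite psi_0; ring).
    rewrite Series_incr_1.
    + rewrite <- (Series_ext _ _ Hz), Series_scal_l; simpl psi; rewrite flat_0.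
      simpl; ring.
    + apply ex_series_incr_1, (ex_series_ext _ _ Hz), ex_series_rise_scal.
  - simpl dlap; rewrite IH, !dflat_0, INR_fact_S; unfold lap_shift; ring.
Qed.

Lemma fact_mult_le (m n : nat) : INR (fact m) * INR (fact n) <= INR (fact (m + n)).
Proof.
  induction m as [|m IH]; [simpl; lra|].
  rewrite Nat.add_succ_l, !INR_fact_S, plus_INR.
  pose proof (INR_fact_pos m); pose proof (INR_fact_pos n); pose proof (INR_fact_pos (m + n)).
  pose proof (pos_INR m); pose proof (pos_INR n); nra.
Qed.

(** Main term and flat terms are both of the size 2^n (2 n)!: truncating at half
    the radius of convergence balances them.  Each derivative adds flat terms
    worth three times this size. *)
Lemma dlap_bound (n j : nat) (N t : R) (k : nat -> R) :
  0 <= t -> lap_coef j N k ->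
  Rabs (dlap n k t) <=
    N * (3 * INR n + 2) * 2 ^ (n + 2 * j) * INR (fact (2 * n + 2 * j)).
Proof.
  intros Ht; revert j N k; induction n as [|n IH]; intros j N k Hk.
  - simpl dlap; unfold lap.
    destruct (Series_rise_bound _ _ _ (lap_weight_psi j N t k Ht Hk)) as [_ H].
    eapply Rle_trans; [exact H|].
    replace (2 * 0 + 2 * j)%nat with (2 * j)%nat by lia.
    replace (0 + 2 * j)%nat with (2 * j)%nat by lia.
    simpl (INR 0); rewrite <- tech_pow_Rmult; right; ring.
  - simpl dlap.
    pose proof (lap_coef_nonneg _ _ _ Hk) as HN.
    pose proof (IH _ _ _ (lap_coef_shift j N k Hk)) as H0.
    destruct (Series_rise_bound _ _ _ (lap_weight_INR j N k Hk)) as [_ H1].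
    destruct (Series_rise_bound N k (2 * j) Hk) as [_ H2].
    pose proof (dflat_bound n 1 t) as D1; pose proof (dflat_bound n 2 t) as D2.
    pose proof (fact_mult_le (S (2 * j)) (1 + 2 * n)) as F1.
    pose proof (fact_mult_le (2 * j) (2 + 2 * n)) as F2.
    replace (S (2 * j) + (1 + 2 * n))%nat with (2 * S n + 2 * j)%nat in F1 by lia.
    replace (2 * j + (2 + 2 * n))%nat with (2 * S n + 2 * j)%nat in F2 by lia.
    replace (2 * n + 2 * S j)%nat with (2 * S n + 2 * j)%nat in H0 by lia.
    replace (n + 2 * S j)%nat with (S (S n + 2 * j)) in H0 by lia.
    set (F := INR (fact (2 * S n + 2 * j))) in *.
    assert (Hpow : 2 ^ (S n + 2 * j) = 2 * 2 ^ n * 2 ^ (2 * j))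
      by (rewrite pow_add; simpl pow; ring).
    assert (Hpos1 : 0 < 2 ^ n) by (apply pow_lt; lra).
    assert (Hpos2 : 0 < 2 ^ (2 * j)) by (apply pow_lt; lra).
    set (X := N * 2 ^ (S n + 2 * j) * F).
    assert (H0' : Rabs (dlap n (lap_shift k) t) <= X * (3 * INR n + 2)).
    { eapply Rle_trans; [exact H0|]; rewrite <- tech_pow_Rmult; unfold X; right; field. }
    assert (H1' : Rabs (Series (fun l => INR l * k l) * dflat n 1 t) <= X * 2).
    { rewrite Rabs_mult.
      eapply Rle_trans; [apply Rmult_le_compat; try apply Rabs_pos; eassumption|].
      unfold X; rewrite Hpow.
      replace (N * (INR (fact (S (2 * j))) * 2 ^ S (S (2 * j))) * (2 ^ n * INR (fact (1 + 2 * n))))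
        with (N * (4 * 2 ^ n * 2 ^ (2 * j)) * (INR (fact (S (2 * j))) * INR (fact (1 + 2 * n))))
        by (rewrite <- !tech_pow_Rmult; ring).
      replace (N * (2 * 2 ^ n * 2 ^ (2 * j)) * F * 2)
        with (N * (4 * 2 ^ n * 2 ^ (2 * j)) * F) by ring.
      apply Rmult_le_compat_l; [|exact F1].
      repeat apply Rmult_le_pos; lra. }
    assert (H2' : Rabs (Series k * dflat n 2 t) <= X).
    { rewrite Rabs_mult.
      eapply Rle_trans; [apply Rmult_le_compat; try apply Rabs_pos; eassumption|].
      unfold X; rewrite Hpow.
      replace (N * (INR (fact (2 * j)) * 2 ^ S (2 * j)) * (2 ^ n * INR (fact (2 + 2 * n))))
        with (N * (2 * 2 ^ n * 2 ^ (2 * j)) * (INR (fact (2 * j)) * INR (fact (2 + 2 * n))))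
        by (rewrite <- !tech_pow_Rmult; ring).
      apply Rmult_le_compat_l; [|exact F2].
      repeat apply Rmult_le_pos; lra. }
    replace (N * (3 * INR (S n) + 2) * 2 ^ (S n + 2 * j) * F)
      with (X * (3 * INR n + 2) + X * 2 + X) by (unfold X; rewrite S_INR; ring).
    unfold Rminus; eapply Rle_trans; [apply Rabs_triang|].
    eapply Rle_trans; [apply Rplus_le_compat_r, Rabs_triang|].
    rewrite !Rabs_Ropp; lra.
Qed.

(** ** From order 2 to order 3 *)

(** The n-th derivative of the sum of the 2^-i lap k (c i t) with c = 9/16. *)
Definition borel (k : nat -> R) (n : nat) (t : R) : R :=
  Series (fun i => (/ 2) ^ i * (9 / 16 * INR i) ^ n * dlap n k (9 / 16 * INR i * t)).

Lemma borel_term_bound (N t : R) (k : nat -> R) (n i : nat) :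
  0 <= t -> lap_coef 0 N k ->
  Rabs ((/ 2) ^ i * (9 / 16 * INR i) ^ n * dlap n k (9 / 16 * INR i * t)) <=
    (/ 2) ^ i * INR i ^ n *
      (N * (3 * INR n + 2) * (9 / 8) ^ n * INR (fact (2 * n))).
Proof.
  intros Ht Hk; pose proof (pos_INR i) as Hi.
  assert (H1 : 0 < (/ 2) ^ i) by (apply pow_lt; lra).
  assert (H2 : 0 <= INR i ^ n) by (apply pow_le; lra).
  assert (H3 : 0 < (9 / 16) ^ n) by (apply pow_lt; lra).
  pose proof (dlap_bound n 0 N (9 / 16 * INR i * t) k ltac:(nra) Hk) as Hb.
  replace (n + 2 * 0)%nat with n in Hb by lia.
  replace (2 * n + 2 * 0)%nat with (2 * n)%nat in Hb by lia.
  rewrite Rpow_mult_distr, Rabs_mult, (Rabs_pos_eq (_ * _))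
    by (repeat apply Rmult_le_pos; lra).
  replace (9 / 8) with (9 / 16 * 2) by field; rewrite Rpow_mult_distr.
  apply Rle_trans with ((/ 2) ^ i * ((9 / 16) ^ n * INR i ^ n) *
    (N * (3 * INR n + 2) * 2 ^ n * INR (fact (2 * n)))).
  - apply Rmult_le_compat_l; [repeat apply Rmult_le_pos; lra|exact Hb].
  - right; ring.
Qed.

Lemma borel_chain (N a : R) (k : nat -> R) :
  lap_coef 0 N k -> derivative_chain 0 a (borel k).
Proof.
  intros Hk n t Ht; unfold borel.
  apply (is_derive_in_series 0 a
    (fun i s => (/ 2) ^ i * (9 / 16 * INR i) ^ n * dlap n k (9 / 16 * INR i * s))
    (fun i s => (/ 2) ^ i * (9 / 16 * INR i) ^ S n * dlap (S n) k (9 / 16 * INR i * s))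
    (fun i => (/ 2) ^ i * INR i ^ S n *
      (N * (3 * INR (S n) + 2) * (9 / 8) ^ S n * INR (fact (2 * S n)))));
    [| | | |exact Ht].
  - intros i s Hs.
    set (c := 9 / 16 * INR i).
    assert (Hc : 0 <= c) by (unfold c; pose proof (pos_INR i); lra).
    replace ((/ 2) ^ i * c ^ S n * dlap (S n) k (c * s))
      with ((/ 2) ^ i * c ^ n * (c * dlap (S n) k (c * s + 0)))
      by (rewrite Rplus_0_r; simpl pow; ring).
    apply is_derive_in_scal.
    apply (is_derive_in_ext 0 a (fun s => dlap n k (c * s + 0))); [exact Hs| |].
    + intros z _; rewrite Rplus_0_r; reflexivity.
    + apply (is_derive_in_affine 0 a 0 (c * a)); [intros z Hz; nra|].
      apply (dlap_chain 0 N (c * a) k Hk n); nra.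
  - intros i s Hs; apply borel_term_bound; [lra|exact Hk].
  - apply (ex_series_scal_r _ _ (ex_series_moment (S n))).
  - intros s Hs; eapply ex_series_bounded.
    + intros i; apply borel_term_bound; [exact (proj1 Hs)|exact Hk].
    + apply (ex_series_scal_r _ _ (ex_series_moment n)).
Qed.

Lemma borel_0 (k : nat -> R) (n : nat) :
  borel k n 0 = (9 / 16) ^ n * moment n * (INR (fact n) ^ 2 * k n).
Proof.
  unfold borel, moment.
  rewrite <- Series_scal_l, <- Series_scal_r; apply Series_ext; intros i.
  rewrite Rmult_0_r, dlap_0, Rpow_mult_distr; ring.
Qed.

Lemma fact_2_3 (n : nat) :
  3 ^ n * (INR (fact n) * INR (fact (2 * n))) <= INR (fact (3 * n)).
Proof.
  induction n as [|n IH]; [simpl; lra|].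
  replace (2 * S n)%nat with (S (S (2 * n))) by lia.
  replace (3 * S n)%nat with (S (S (S (3 * n)))) by lia.
  rewrite !INR_fact_S, !S_INR, !mult_INR.
  replace (INR 2) with 2 by (simpl; ring); replace (INR 3) with 3 by (simpl; ring).
  simpl pow; pose proof (pos_INR n) as Hn.
  set (x := INR n) in *; set (P := 3 ^ n * (INR (fact n) * INR (fact (2 * n)))) in *.
  assert (HP : 0 <= P).
  { unfold P; pose proof (INR_fact_pos n); pose proof (INR_fact_pos (2 * n)).
    apply Rmult_le_pos; [apply pow_le; lra|apply Rmult_le_pos; lra]. }
  apply Rle_trans with (3 * (x + 1) * (2 * x + 1 + 1) * (2 * x + 1) * P);
    [right; unfold P; ring|].
  apply Rle_trans with ((3 * x + 1 + 1 + 1) * (3 * x + 1 + 1) * (3 * x + 1) * P).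
  - apply Rmult_le_compat_r; [exact HP|nra].
  - replace ((3 * x + 1 + 1 + 1) * ((3 * x + 1 + 1) * ((3 * x + 1) * INR (fact (3 * n)))))
      with ((3 * x + 1 + 1 + 1) * (3 * x + 1 + 1) * (3 * x + 1) * INR (fact (3 * n))) by ring.
    apply Rmult_le_compat_l; [|exact IH].
    repeat apply Rmult_le_pos; lra.
Qed.

(** The moments contribute n! 2^n and the dilations (9/16)^n; with the 2^n (2 n)!
    of [dlap_bound], the factor (9/4)^n n! (2 n)! becomes (3/4)^n (3 n)! because
    3^n n! (2 n)! <= (3 n)!. *)
Lemma borel_bound (N t : R) (k : nat -> R) (n : nat) :
  0 <= t -> lap_coef 0 N k ->
  Rabs (borel k n t) <= 4 * N * (3 / 4) ^ n * INR (fact (3 * n + 1)).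
Proof.
  intros Ht Hk; pose proof (lap_coef_nonneg _ _ _ Hk) as HN; pose proof (pos_INR n) as Hn.
  set (c := N * (3 * INR n + 2) * (9 / 8) ^ n * INR (fact (2 * n))).
  assert (Hc : 0 <= c).
  { unfold c; pose proof (INR_fact_pos (2 * n)).
    repeat apply Rmult_le_pos; try (apply pow_le); lra. }
  apply Rle_trans with (moment n * c).
  { unfold borel, moment; rewrite <- Series_scal_r; apply Series_bounded.
    - intros i; apply borel_term_bound; assumption.
    - apply (ex_series_scal_r _ _ (ex_series_moment n)). }
  apply Rle_trans with (INR (fact n) * 2 ^ S n * c);
    [apply Rmult_le_compat_r; [exact Hc|apply moment_le]|].
  assert (H94 : (9 / 8) ^ n * 2 ^ n = (3 / 4) ^ n * 3 ^ n)
    by (rewrite <- !Rpow_mult_distr; f_equal; field).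
  replace (INR (fact n) * 2 ^ S n * c) with
    (2 * N * (3 * INR n + 2) * ((9 / 8) ^ n * 2 ^ n) * (INR (fact n) * INR (fact (2 * n))))
    by (unfold c; simpl pow; ring).
  rewrite H94.
  replace (2 * N * (3 * INR n + 2) * ((3 / 4) ^ n * 3 ^ n) * (INR (fact n) * INR (fact (2 * n))))
    with (2 * N * (3 / 4) ^ n * (3 * INR n + 2) *
            (3 ^ n * (INR (fact n) * INR (fact (2 * n))))) by ring.
  pose proof (fact_2_3 n) as H23; pose proof (INR_fact_pos (3 * n)) as Hf.
  assert (Hp : 0 < (3 / 4) ^ n) by (apply pow_lt; lra).
  apply Rle_trans with (2 * N * (3 / 4) ^ n * (3 * INR n + 2) * INR (fact (3 * n))).
  - apply Rmult_le_compat_l; [repeat apply Rmult_le_pos; lra|exact H23].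
  - rewrite Nat.add_1_r, INR_fact_S, mult_INR; replace (INR 3) with 3 by (simpl; ring).
    replace (4 * N * (3 / 4) ^ n * ((3 * INR n + 1) * INR (fact (3 * n))))
      with (2 * N * (3 / 4) ^ n * (2 * (3 * INR n + 1)) * INR (fact (3 * n))) by ring.
    apply Rmult_le_compat_r; [lra|].
    apply Rmult_le_compat_l; [repeat apply Rmult_le_pos; lra|lra].
Qed.

Lemma fact_3_le (l : nat) : INR (fact (3 * l)) <= 27 ^ l * INR (fact l) ^ 3.
Proof.
  induction l as [|l IH]; [simpl; lra|].
  replace (3 * S l)%nat with (S (S (S (3 * l)))) by lia.
  rewrite !INR_fact_S, !S_INR, !mult_INR; replace (INR 3) with 3 by (simpl; ring).
  pose proof (pos_INR l) as Hl; set (x := INR l) in *.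
  pose proof (INR_fact_pos (3 * l)) as Hf.
  apply Rle_trans with (27 * (x + 1) ^ 3 * INR (fact (3 * l))).
  - rewrite <- !Rmult_assoc; apply Rmult_le_compat_r; [lra|simpl pow; nra].
  - replace (27 ^ S l * ((x + 1) * INR (fact l)) ^ 3)
      with (27 * (x + 1) ^ 3 * (27 ^ l * INR (fact l) ^ 3)) by (simpl pow; ring).
    apply Rmult_le_compat_l; [|exact IH].
    apply Rmult_le_pos; [lra|apply pow_le; lra].
Qed.

(** Any ratio greater than 1 would do; 9/7 is what the choice of 9/16 in [borel]
    leaves. *)
Lemma rise_3_le : exists K : R, 0 < K /\ forall l : nat, rise 3 l <= K * (9 / 7) ^ l.
Proof.
  exists (INR (fact 3) / (1 - 7 / 9) ^ 4); split.
  - apply Rdiv_lt_0_compat; [apply INR_fact_pos|apply pow_lt; lra].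
  - intros l.
    assert (H : rise 3 l * (7 / 9) ^ l <= INR (fact 3) / (1 - 7 / 9) ^ 4).
    { apply (is_series_term_le (fun l => rise 3 l * (7 / 9) ^ l)).
      - intros i; apply Rmult_le_pos; [left; apply rise_pos|apply pow_le; lra].
      - apply is_series_rise; lra. }
    assert (Hp : 0 < (9 / 7) ^ l) by (apply pow_lt; lra).
    apply (Rmult_le_compat_r ((9 / 7) ^ l)) in H; [|lra].
    rewrite Rmult_assoc, <- Rpow_mult_distr in H.
    replace (7 / 9 * (9 / 7)) with 1 in H by field; rewrite pow1, Rmult_1_r in H; exact H.
Qed.

(** The coefficients d_l / (moment_l (l!)^2 c^l) decay like 2^-l, since
    (3 l)! <= 27^l (l!)^3 and 27 * (7/864) * (9/7) * (16/9) = 1/2. *)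
Lemma borel_gevrey3 :
  exists C : R, 0 < C /\
    forall (d : nat -> R) (N : R),
      (forall l : nat, Rabs (d l) <= N * (7 / 864) ^ l * INR (fact (3 * l + 3))) ->
      exists F : nat -> R -> R,
        (forall n : nat, F n 0 = d n) /\
        (forall a : R, derivative_chain 0 a F) /\
        (forall (n : nat) (t : R), 0 <= t ->
           Rabs (F n t) <= C * N * (3 / 4) ^ n * INR (fact (3 * n + 1))).
Proof.
  destruct rise_3_le as [K [HK Hrise]].
  exists (4 * (27 * K)); split; [lra|].
  intros d N Hd.
  assert (HN : 0 <= N).
  { pose proof (Hd O) as H0; pose proof (Rabs_pos (d O)); simpl in H0; lra. }
  set (k := fun l => d l / (moment l * INR (fact l) ^ 2 * (9 / 16) ^ l)).
  assert (Hmom : forall l, 0 < moment l)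
    by (intros l; eapply Rlt_le_trans; [apply INR_fact_pos|apply moment_ge]).
  assert (Hden : forall l, 0 < moment l * INR (fact l) ^ 2 * (9 / 16) ^ l).
  { intros l; apply Rmult_lt_0_compat; [apply Rmult_lt_0_compat|].
    - apply Hmom.
    - apply pow_lt, INR_fact_pos.
    - apply pow_lt; lra. }
  assert (Hk : lap_coef 0 (27 * K * N) k).
  { intros l; replace (2 * 0)%nat with O by lia; rewrite rise_O, Rmult_1_l.
    unfold k, Rdiv; rewrite Rabs_mult, Rabs_inv, (Rabs_pos_eq (moment l * _ * _))
      by (left; apply Hden).
    apply (Rmult_le_reg_r (moment l * INR (fact l) ^ 2 * (9 / 16) ^ l)); [apply Hden|].
    rewrite Rmult_assoc, Rinv_l, Rmult_1_r by (apply Rgt_not_eq, Hden).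
    eapply Rle_trans; [apply Hd|].
    pose proof (INR_fact_pos l) as Hf; pose proof (pos_INR l) as Hl.
    assert (H3 : INR (fact (3 * l + 3)) <= 27 * rise 3 l * (27 ^ l * INR (fact l) ^ 3)).
    { replace (3 * l + 3)%nat with (S (S (S (3 * l)))) by lia.
      rewrite !INR_fact_S, !S_INR, !mult_INR; replace (INR 3) with 3 by (simpl; ring).
      rewrite !rise_S, rise_O, !S_INR; simpl (INR 0).
      apply Rle_trans with ((3 * INR l + 1 + 1 + 1) * (3 * INR l + 1 + 1) * (3 * INR l + 1)
         * INR (fact (3 * l))); [right; ring|].
      pose proof (INR_fact_pos (3 * l)).
      apply Rmult_le_compat; [repeat apply Rmult_le_pos; lra|lra|nra|apply fact_3_le]. }
    assert (H4 : 27 * rise 3 l * (27 ^ l * INR (fact l) ^ 3) <=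
                 27 * (K * (9 / 7) ^ l) * (27 ^ l * INR (fact l) ^ 3)).
    { apply Rmult_le_compat_r; [apply Rmult_le_pos; apply pow_le; lra|].
      apply Rmult_le_compat_l; [lra|apply Hrise]. }
    assert (Hc : (7 / 864) ^ l * (9 / 7) ^ l * 27 ^ l = (/ 2) ^ l * (9 / 16) ^ l)
      by (rewrite <- !Rpow_mult_distr; f_equal; field).
    apply Rle_trans with (27 * K * N * ((/ 2) ^ l * (9 / 16) ^ l) * INR (fact l) ^ 2
                            * INR (fact l)).
    - rewrite <- Hc.
      apply Rle_trans with (N * (7 / 864) ^ l * (27 * (K * (9 / 7) ^ l) * (27 ^ l * INR (fact l) ^ 3)));
        [|right; ring].
      apply Rmult_le_compat_l; [apply Rmult_le_pos; [lra|apply pow_le; lra]|lra].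
    - replace (27 * K * N * (/ 2) ^ l * (moment l * INR (fact l) ^ 2 * (9 / 16) ^ l))
        with (27 * K * N * ((/ 2) ^ l * (9 / 16) ^ l) * INR (fact l) ^ 2 * moment l) by ring.
      apply Rmult_le_compat_l; [|apply moment_ge].
      assert (0 < (/ 2) ^ l) by (apply pow_lt; lra).
      assert (0 < (9 / 16) ^ l) by (apply pow_lt; lra).
      assert (0 < INR (fact l) ^ 2) by (apply pow_lt; lra).
      repeat apply Rmult_le_pos; lra. }
  exists (borel k); split; [|split].
  - intros n; rewrite borel_0; unfold k; field.
    pose proof (Hmom n); pose proof (INR_fact_pos n).
    repeat split; try (apply pow_nonzero); lra.
  - intros a; exact (borel_chain _ a k Hk).
  - intros n t Ht; eapply Rle_trans; [apply borel_bound; eassumption|right; ring].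
Qed.

(** * Steering the trace y_xx(0, t) *)

Lemma derivative_chain_reflect (T : R) (F : nat -> R -> R) :
  derivative_chain 0 T F ->
  derivative_chain 0 T (fun n t => (-1) ^ n * F n (T - t)).
Proof.
  intros HF n t Ht.
  replace ((-1) ^ S n * F (S n) (T - t))
    with ((-1) ^ n * (-1 * F (S n) (-1 * t + T)))
    by (replace (-1 * t + T) with (T - t) by ring; simpl pow; ring).
  apply is_derive_in_scal.
  apply (is_derive_in_ext 0 T (fun s => F n (-1 * s + T))); [exact Ht| |].
  - intros z _; f_equal; ring.
  - apply (is_derive_in_affine 0 T 0 T); [intros z Hz; lra|].
    apply HF; lra.
Qed.

Lemma derivative_chain_leib (a b : R) (F G : nat -> R -> R) :
  derivative_chain a b F -> derivative_chain a b G ->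
  derivative_chain a b (fun n t => leib (fun j => F j t) (fun j => G j t) n).
Proof.
  intros HF HG n t Ht.
  apply (is_derive_in_leib a b t (fun s j => F j s) (fun s j => G j s));
    intros j; [apply HF|apply HG]; exact Ht.
Qed.

(** ** A cutoff function *)

Lemma flat_lipschitz (x z : R) : Rabs (flat 0 z - flat 0 x) <= 2 * Rabs (z - x).
Proof.
  assert (Hm : forall s, flat 0 s = flat 0 (Rmax 0 s)).
  { intros s; unfold Rmax; destruct (Rle_dec 0 s); [reflexivity|].
    rewrite flat_0; apply flat_nonpos; lra. }
  rewrite (Hm z), (Hm x).
  apply Rle_trans with (2 * Rabs (Rmax 0 z - Rmax 0 x)).
  - apply (lipschitz_of_derive_in 0 (Rmax (Rmax 0 z) (Rmax 0 x)) 2 (flat 0)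
      (fun t => flat 2 t - INR 0 * flat 1 t)).
    + intros t Ht; apply is_derive_in_flat, Ht.
    + intros t _; simpl (INR 0); pose proof (flat_bounds 2 t) as H; simpl INR in H.
      apply Rabs_le; lra.
    + split; [apply Rmax_l|apply Rmax_r].
    + split; [apply Rmax_l|apply Rmax_l].
  - apply Rmult_le_compat_l; [lra|].
    unfold Rmax, Rabs; repeat destruct Rle_dec; repeat destruct Rcase_abs; lra.
Qed.

Lemma continuous_flat (x : R) : continuous (flat 0) x.
Proof.
  apply continuity_pt_filterlim; intros eps Heps.
  exists (eps / 2); split; [lra|]; intros z [_ Hz].
  simpl in *; unfold Rdist in *; pose proof (flat_lipschitz x z); lra.
Qed.

(** Flat at 0 and at T, hence so is the derivative of its antiderivative. *)
Definition bump (T t : R) : R := flat 0 t * flat 0 (T - t).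

Lemma continuous_bump (T x : R) : continuous (bump T) x.
Proof.
  apply (continuous_mult (flat 0)); [apply continuous_flat|].
  apply (continuous_comp (fun t => T - t) (flat 0)); [|apply continuous_flat].
  apply (continuous_minus (fun _ : R => T)); [apply continuous_const|apply continuous_id].
Qed.

Definition bump_mass (T : R) : R := RInt (bump T) 0 T.

Lemma bump_mass_pos (T : R) : 0 < T -> 0 < bump_mass T.
Proof.
  intros HT; apply (RInt_gt_0 (bump T) 0 T HT);
    [|intros x _; apply continuous_bump].
  assert (Hpos : forall s, 0 < s -> 0 < flat 0 s).
  { intros s Hs; unfold flat; destruct (Rlt_dec 0 s); [|lra].
    simpl; pose proof (exp_pos (- / s)); lra. }
  intros t Ht; apply Rmult_lt_0_compat; apply Hpos; lra.
Qed.

Definition dbump (T : R) (n : nat) (t : R) : R :=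
  leib (fun j => dflat j 0 t) (fun j => (-1) ^ j * dflat j 0 (T - t)) n.

(** The n-th derivative of the cutoff function, which decreases from 1 to 0. *)
Definition cutoff (T : R) (n : nat) (t : R) : R :=
  match n with
  | O => / bump_mass T * RInt (bump T) t T
  | S m => - / bump_mass T * dbump T m t
  end.

Lemma dbump_chain (T : R) : derivative_chain 0 T (dbump T).
Proof.
  apply (derivative_chain_leib 0 T (fun j => dflat j 0)).
  - apply dflat_chain.
  - apply (derivative_chain_reflect T (fun j => dflat j 0)), dflat_chain.
Qed.

Lemma cutoff_chain (T : R) : derivative_chain 0 T (cutoff T).
Proof.
  intros [|n] t Ht.
  - replace (cutoff T 1 t) with (/ bump_mass T * - bump T t)
      by (unfold cutoff, dbump, bump; simpl; ring).
    apply is_derive_in_scal, is_derive_in_of_is_derive.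
    apply (is_derive_RInt' (bump T) _ t T); [|apply continuous_bump].
    apply filter_forall; intros s; apply (RInt_correct (bump T)).
    apply (ex_RInt_continuous (bump T)); intros z _; apply continuous_bump.
  - apply is_derive_in_scal, dbump_chain, Ht.
Qed.

Lemma cutoff_start (T : R) : 0 < T ->
  cutoff T 0 0 = 1 /\ forall n : nat, cutoff T (S n) 0 = 0.
Proof.
  intros HT; split.
  - unfold cutoff; fold (bump_mass T); apply Rinv_l.
    pose proof (bump_mass_pos T HT); lra.
  - intros n; unfold cutoff, dbump; rewrite leib_zero_l; [ring|].
    intros j; apply dflat_0.
Qed.

Lemma cutoff_end (T : R) (n : nat) : cutoff T n T = 0.
Proof.
  destruct n as [|n]; unfold cutoff.
  - rewrite RInt_point; unfold zero; simpl; ring.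
  - unfold dbump; rewrite leib_zero_r; [ring|].
    intros j; rewrite Rminus_diag, dflat_0; ring.
Qed.

(** A function of order 2 also satisfies bounds of order 3, here with the ratio
    3/4 of the Borel theorem: no geometric factor is lost in their product. *)
Lemma dflat_bound3 (j : nat) (t : R) :
  Rabs (dflat j 0 t) <= 1 * (3 / 4) ^ j * INR (fact (3 * j + 0)).
Proof.
  eapply Rle_trans; [apply dflat_bound|].
  rewrite Nat.add_0_l, Nat.add_0_r; pose proof (fact_2_3 j) as H.
  pose proof (INR_fact_le 0 j ltac:(lia)) as H1; simpl (INR (fact 0)) in H1.
  pose proof (INR_fact_pos (2 * j)) as H2.
  assert (Hp : 0 < (2 / 3) ^ j) by (apply pow_lt; lra).
  assert (H3 : 0 < 3 ^ j) by (apply pow_lt; lra).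
  assert (Hq : (2 / 3) ^ j <= (3 / 4) ^ j) by (apply pow_incr; lra).
  assert (H23 : 2 ^ j = (2 / 3) ^ j * 3 ^ j)
    by (rewrite <- Rpow_mult_distr; f_equal; field).
  assert (H4 : 3 ^ j * INR (fact (2 * j)) <= INR (fact (3 * j))).
  { eapply Rle_trans; [|exact H]; apply Rmult_le_compat_l; [lra|nra]. }
  rewrite H23, Rmult_assoc, Rmult_1_l.
  apply Rmult_le_compat; [lra|apply Rmult_le_pos; lra|exact Hq|exact H4].
Qed.

Lemma dbump_bound (T : R) (n : nat) (t : R) :
  Rabs (dbump T n t) <= (3 / 4) ^ n * INR (fact (3 * n + 1)).
Proof.
  eapply Rle_trans; [apply (leib_bound n 0 0 1 1 (3 / 4))|]; try lra.
  - intros j; apply dflat_bound3.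
  - intros j; rewrite Rabs_mult, pow_1_abs, Rmult_1_l; apply dflat_bound3.
  - replace (beta 0 0) with 1 by (unfold beta; simpl; field).
    replace (3 * n + (0 + 0 + 1))%nat with (3 * n + 1)%nat by lia; right; ring.
Qed.

Lemma cutoff_bound (T : R) (n : nat) (t : R) : 0 <= t <= T -> 0 < T ->
  Rabs (cutoff T n t) <=
    (T + 4 / 3) / bump_mass T * (3 / 4) ^ n * INR (fact (3 * n + 0)).
Proof.
  intros Ht HT; pose proof (bump_mass_pos T HT) as HI.
  assert (HI' : 0 < / bump_mass T) by (apply Rinv_0_lt_compat; exact HI).
  assert (Hder : forall m s, Rabs (cutoff T (S m) s) <=
            / bump_mass T * ((3 / 4) ^ m * INR (fact (3 * m + 1)))).
  { intros m s; unfold cutoff; rewrite Rabs_mult, Rabs_Ropp, (Rabs_pos_eq (/ _)) by lra.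
    apply Rmult_le_compat_l; [lra|apply dbump_bound]. }
  destruct n as [|n].
  (* The function itself is bounded through its derivative, as it vanishes at T. *)
  - pose proof (lipschitz_of_derive_in 0 T (/ bump_mass T) (cutoff T 0) (cutoff T 1)
      (cutoff_chain T 0%nat)) as HL.
    assert (H0 : forall s, 0 <= s <= T -> Rabs (cutoff T 1 s) <= / bump_mass T).
    { intros s _; eapply Rle_trans; [apply Hder|]; right.
      simpl (INR (fact _)); ring. }
    specialize (HL H0 T t ltac:(lra) Ht); rewrite (cutoff_end T 0), Rminus_0_r in HL.
    eapply Rle_trans; [exact HL|].
    rewrite Rabs_minus_sym, Rabs_pos_eq by lra.
    apply Rle_trans with (/ bump_mass T * (T + 4 / 3)).
    + apply Rmult_le_compat_l; lra.
    + simpl (INR (fact _)); unfold Rdiv; right; ring.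
  - eapply Rle_trans; [apply Hder|].
    pose proof (INR_fact_le (3 * n + 1) (3 * S n + 0) ltac:(lia)) as Hf.
    assert (Hp : 0 < (3 / 4) ^ n) by (apply pow_lt; lra).
    pose proof (INR_fact_pos (3 * S n + 0)) as Hf0.
    simpl pow.
    replace ((T + 4 / 3) / bump_mass T * (3 / 4 * (3 / 4) ^ n) * INR (fact (3 * S n + 0)))
      with (/ bump_mass T * ((T + 4 / 3) * (3 / 4) * ((3 / 4) ^ n * INR (fact (3 * S n + 0)))))
      by (unfold Rdiv; ring).
    apply Rmult_le_compat_l; [lra|].
    assert (0 < (3 / 4) ^ n * INR (fact (3 * S n + 0))) by (apply Rmult_lt_0_compat; lra).
    assert ((3 / 4) ^ n * INR (fact (3 * n + 1)) <= (3 / 4) ^ n * INR (fact (3 * S n + 0)))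
      by (apply Rmult_le_compat_l; lra).
    nra.
Qed.

(** ** Prescribing the derivatives at both ends *)

Lemma borel_cutoff (T : R) : 0 < T ->
  exists C : R, 0 < C /\
    forall (d : nat -> R) (N : R),
      (forall l : nat, Rabs (d l) <= N * (7 / 864) ^ l * INR (fact (3 * l + 3))) ->
      exists F : nat -> R -> R,
        derivative_chain 0 T F /\
        (forall n : nat, F n 0 = d n) /\ (forall n : nat, F n T = 0) /\
        (forall (n : nat) (t : R), 0 <= t <= T ->
           Rabs (F n t) <= C * N * (3 / 4) ^ n * INR (fact (3 * n + 3))).
Proof.
  intros HT; destruct borel_gevrey3 as [C [HC Hborel]].
  set (K := (T + 4 / 3) / bump_mass T).
  assert (HK : 0 < K) by (apply Rdiv_lt_0_compat; [lra|apply bump_mass_pos, HT]).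
  exists (C * K); split; [apply Rmult_lt_0_compat; assumption|].
  intros d N Hd; destruct (Hborel d N Hd) as [F [HF0 [HF HFb]]].
  assert (HN : 0 <= N).
  { pose proof (Hd O) as H0; pose proof (Rabs_pos (d O)); simpl in H0; lra. }
  destruct (cutoff_start T HT) as [Hc0 HcS].
  exists (fun n t => leib (fun j => F j t) (fun j => cutoff T j t) n).
  split; [|split; [|split]].
  - apply derivative_chain_leib; [apply HF|apply cutoff_chain].
  - intros n; rewrite leib_unit_r; [apply HF0|exact Hc0|exact HcS].
  - intros n; apply leib_zero_r; intros j; apply cutoff_end.
  - intros n t Ht.
    assert (HCN : 0 <= C * N) by (apply Rmult_le_pos; lra).
    eapply Rle_trans; [apply (leib_bound n 1 0 (C * N) K (3 / 4)); try lra|].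
    + intros j; apply HFb; lra.
    + intros j; apply cutoff_bound; assumption.
    + replace (beta 1 0) with (/ 2) by (unfold beta; simpl; field).
      pose proof (INR_fact_le (3 * n + (1 + 0 + 1)) (3 * n + 3) ltac:(lia)) as Hf.
      pose proof (INR_fact_pos (3 * n + (1 + 0 + 1))).
      assert (Hp : 0 < (3 / 4) ^ n) by (apply pow_lt; lra).
      replace (C * K * N) with (C * N * K) by ring.
      assert (HCNK : 0 <= C * N * K) by (apply Rmult_le_pos; lra).
      apply Rmult_le_compat_l; [apply Rmult_le_pos; lra|lra].
Qed.

Lemma two_point_borel (T : R) : 0 < T ->
  exists C : R, 0 < C /\
    forall (d d' : nat -> R) (N : R),
      (forall l : nat, Rabs (d l) <= N * (7 / 864) ^ l * INR (fact (3 * l + 3))) ->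
      (forall l : nat, Rabs (d' l) <= N * (7 / 864) ^ l * INR (fact (3 * l + 3))) ->
      exists F : nat -> R -> R,
        derivative_chain 0 T F /\
        (forall n : nat, F n 0 = d n) /\ (forall n : nat, F n T = d' n) /\
        (forall (n : nat) (t : R), 0 <= t <= T ->
           Rabs (F n t) <= C * N * (3 / 4) ^ n * INR (fact (3 * n + 3))).
Proof.
  intros HT; destruct (borel_cutoff T HT) as [C [HC H]].
  exists (2 * C); split; [lra|]; intros d d' N Hd Hd'.
  destruct (H d N Hd) as [F [HF [HF0 [HFT HFb]]]].
  destruct (H (fun l => (-1) ^ l * d' l) N) as [G [HG [HG0 [HGT HGb]]]].
  { intros l; rewrite Rabs_mult, pow_1_abs, Rmult_1_l; apply Hd'. }
  exists (fun n t => F n t + (-1) ^ n * G n (T - t)); split; [|split; [|split]].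
  - intros n t Ht; apply is_derive_in_plus; [apply HF, Ht|].
    exact (derivative_chain_reflect T G HG n t Ht).
  - intros n; rewrite HF0, Rminus_0_r, HGT; ring.
  - intros n; rewrite HFT, Rminus_diag, HG0, <- Rmult_assoc, <- Rpow_mult_distr.
    replace (-1 * -1) with 1 by ring; rewrite pow1; ring.
  - intros n t Ht; eapply Rle_trans; [apply Rabs_triang|].
    rewrite Rabs_mult, pow_1_abs, Rmult_1_l.
    pose proof (HFb n t Ht); pose proof (HGb n (T - t) ltac:(lra)); lra.
Qed.

(** * Sums of Taylor series *)

Definition taylor (c : nat -> R) (x : R) : R :=
  PSeries (fun n => c n / INR (fact n)) x.

(** The majorants M z^n (n + s)! of Taylor coefficients, with z < 1, give a
    radius of convergence greater than 1, for every s. *)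
Definition taylor_coef (z M : R) (s : nat) (c : nat -> R) : Prop :=
  forall n : nat, Rabs (c n) <= M * z ^ n * INR (fact (n + s)).

Lemma taylor_coef_term (z M : R) (s : nat) (c : nat -> R) (n : nat) :
  taylor_coef z M s c -> Rabs (c n / INR (fact n)) <= M * (rise s n * z ^ n).
Proof.
  intros H; pose proof (INR_fact_pos n) as Hf.
  unfold Rdiv; rewrite Rabs_mult, Rabs_inv, (Rabs_pos_eq (INR _)) by lra.
  apply (Rmult_le_reg_r (INR (fact n))); [exact Hf|].
  rewrite Rmult_assoc, Rinv_l, Rmult_1_r by lra.
  eapply Rle_trans; [apply H|]; unfold rise; right; field; lra.
Qed.

Lemma taylor_coef_nonneg (z M : R) (s : nat) (c : nat -> R) :
  taylor_coef z M s c -> 0 <= M.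
Proof.
  intros H; specialize (H O); pose proof (Rabs_pos (c O)); pose proof (INR_fact_pos (0 + s)).
  simpl pow in H; nra.
Qed.

Lemma taylor_radius (z M x : R) (s : nat) (c : nat -> R) :
  0 < z < 1 -> taylor_coef z M s c -> Rabs x <= 1 ->
  Rbar_lt (Rabs x) (CV_radius (fun n => c n / INR (fact n))).
Proof.
  intros Hz H Hx.
  set (r := (1 + z) / (2 * z)).
  assert (Hr : 1 < r).
  { unfold r; apply (Rmult_lt_reg_r (2 * z)); [lra|].
    replace ((1 + z) / (2 * z) * (2 * z)) with (1 + z) by (field; lra); lra. }
  apply Rbar_lt_le_trans with r; [simpl; lra|].
  apply (proj1 (CV_radius_bounded (fun n => c n / INR (fact n)))).
  pose proof (taylor_coef_nonneg _ _ _ _ H) as HM.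
  set (w := (1 + z) / 2).
  exists (M * (INR (fact s) / (1 - w) ^ S s)); intros n.
  rewrite Rabs_mult, (Rabs_pos_eq (r ^ n)) by (apply pow_le; lra).
  apply Rle_trans with (M * (rise s n * z ^ n) * r ^ n).
  - apply Rmult_le_compat_r; [apply pow_le; lra|apply taylor_coef_term, H].
  - rewrite !Rmult_assoc, <- Rpow_mult_distr.
    replace (z * r) with w by (unfold w, r; field; lra).
    apply Rmult_le_compat_l; [exact HM|].
    apply (is_series_term_le (fun l => rise s l * w ^ l)).
    + intros k; apply Rmult_le_pos; [left; apply rise_pos|apply pow_le; unfold w; lra].
    + apply is_series_rise; unfold w; lra.
Qed.

Lemma taylor_term_bound (z M x : R) (s : nat) (c : nat -> R) (n : nat) :
  taylor_coef z M s c -> Rabs x <= 1 ->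
  Rabs (c n / INR (fact n) * x ^ n) <= M * (rise s n * z ^ n).
Proof.
  intros H Hx; rewrite Rabs_mult.
  pose proof (taylor_coef_term z M s c n H) as H1.
  rewrite <- RPow_abs.
  assert (H2 : Rabs x ^ n <= 1) by (rewrite <- (pow1 n); apply pow_incr; split;
    [apply Rabs_pos|exact Hx]).
  assert (H3 : 0 <= Rabs x ^ n) by (apply pow_le, Rabs_pos).
  pose proof (Rabs_pos (c n / INR (fact n))); nra.
Qed.

Lemma taylor_bound (z M x : R) (s : nat) (c : nat -> R) :
  0 < z < 1 -> taylor_coef z M s c -> Rabs x <= 1 ->
  Rabs (taylor c x) <= M * (INR (fact s) / (1 - z) ^ S s).
Proof.
  intros Hz H Hx; pose proof (is_series_rise s z ltac:(lra)) as Hs.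
  rewrite <- (is_series_unique _ _ Hs), <- Series_scal_l.
  apply Series_bounded.
  - intros n; apply taylor_term_bound; assumption.
  - apply (ex_series_scal_l M (fun l => rise s l * z ^ l)); eexists; exact Hs.
Qed.

Lemma is_derive_taylor (z M x : R) (s : nat) (c : nat -> R) :
  0 < z < 1 -> taylor_coef z M s c -> Rabs x <= 1 ->
  is_derive (taylor c) x (taylor (fun n => c (S n)) x).
Proof.
  intros Hz H Hx; unfold taylor.
  rewrite (PSeries_ext _ (PS_derive (fun n => c n / INR (fact n)))).
  - apply is_derive_PSeries, (taylor_radius z M x s); assumption.
  - intros n; unfold PS_derive; rewrite INR_fact_S, S_INR.
    pose proof (INR_fact_pos n); pose proof (pos_INR n); field; split; lra.
Qed.

Lemma taylor_0 (c : nat -> R) : taylor c 0 = c O.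
Proof. unfold taylor; rewrite PSeries_0; simpl; field. Qed.

Lemma taylor_minus2 (z M M' M'' x : R) (s s' s'' : nat) (c d e : nat -> R) :
  0 < z < 1 -> taylor_coef z M s c -> taylor_coef z M' s' d -> taylor_coef z M'' s'' e ->
  Rabs x <= 1 ->
  taylor (fun n => c n - d n - e n) x = taylor c x - taylor d x - taylor e x.
Proof.
  intros Hz Hc Hd He Hx; unfold taylor.
  pose proof (CV_radius_inside _ _ (taylor_radius z M x s c Hz Hc Hx)) as Ec.
  pose proof (CV_radius_inside _ _ (taylor_radius z M' x s' d Hz Hd Hx)) as Ed.
  pose proof (CV_radius_inside _ _ (taylor_radius z M'' x s'' e Hz He Hx)) as Ee.
  rewrite <- PSeries_minus by assumption.
  rewrite <- PSeries_minus by (try apply (ex_pseries_minus _ _ x Ec Ed); assumption).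
  apply PSeries_ext; intros n; unfold PS_minus, PS_plus, PS_opp, plus, opp; simpl.
  unfold Rdiv; ring.
Qed.

Lemma PS_mult_derive (a b : nat -> R) (n : nat) :
  (INR n + 1) * PS_mult a b (S n) = PS_mult (PS_derive a) b n + PS_mult a (PS_derive b) n.
Proof.
  unfold PS_mult.
  assert (H1 : sum_f_R0 (fun k => PS_derive a k * b (n - k)%nat) n =
               sum_f_R0 (fun k => INR k * (a k * b (S n - k)%nat)) (S n)).
  { rewrite (decomp_sum (fun k => INR k * (a k * b (S n - k)%nat))) by lia.
    simpl (INR 0); rewrite Rmult_0_l, Rplus_0_l; simpl pred.
    apply sum_eq; intros k Hk; unfold PS_derive; simpl (S n - S k)%nat; ring. }
  assert (H2 : sum_f_R0 (fun k => a k * PS_derive b (n - k)) n =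
               sum_f_R0 (fun k => INR (S n - k) * (a k * b (S n - k)%nat)) (S n)).
  { rewrite tech5, Nat.sub_diag; simpl (INR 0); rewrite Rmult_0_l, Rplus_0_r.
    apply sum_eq; intros k Hk; unfold PS_derive.
    replace (S n - k)%nat with (S (n - k)) by lia; ring. }
  rewrite H1, H2, <- sum_plus, <- S_INR, scal_sum; apply sum_eq; intros k Hk.
  rewrite minus_INR by lia; ring.
Qed.

(** Both sides satisfy the recursion that defines [leib]. *)
Lemma leib_PS_mult (c d : nat -> R) (n : nat) :
  leib c d n / INR (fact n) =
  PS_mult (fun k => c k / INR (fact k)) (fun k => d k / INR (fact k)) n.
Proof.
  revert c d; induction n as [|n IH]; intros c d.
  - unfold PS_mult; simpl; field.
  - assert (Hder : forall e k, PS_derive (fun k => e k / INR (fact k)) k = e (S k) / INR (fact k)).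
    { intros e k; unfold PS_derive; rewrite INR_fact_S, S_INR.
      pose proof (INR_fact_pos k); pose proof (pos_INR k); field; split; lra. }
    pose proof (PS_mult_derive (fun k => c k / INR (fact k)) (fun k => d k / INR (fact k)) n) as H.
    rewrite (functional_extensionality _ _ (Hder c)), (functional_extensionality _ _ (Hder d)) in H.
    rewrite <- !IH in H.
    pose proof (INR_fact_pos n); pose proof (pos_INR n).
    apply (Rmult_eq_reg_l (INR n + 1)); [|lra]; rewrite H.
    simpl leib; rewrite INR_fact_S; field; split; lra.
Qed.

Lemma taylor_mult (z M M' x : R) (s s' : nat) (c d : nat -> R) :
  0 < z < 1 -> taylor_coef z M s c -> taylor_coef z M' s' d -> Rabs x <= 1 ->
  taylor (leib c d) x = taylor c x * taylor d x.
Proof.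
  intros Hz Hc Hd Hx; unfold taylor.
  rewrite <- PSeries_mult.
  - apply PSeries_ext; intros n; apply leib_PS_mult.
  - apply (taylor_radius z M x s); assumption.
  - apply (taylor_radius z M' x s'); assumption.
Qed.

Lemma taylor_coef_shift (z M : R) (s n : nat) (c : nat -> R) :
  taylor_coef z M s c -> taylor_coef z (M * z ^ n) (n + s) (fun i => c (n + i)%nat).
Proof.
  intros H i; eapply Rle_trans; [apply H|].
  replace (n + i + s)%nat with (i + (n + s))%nat by lia; rewrite pow_add; right; ring.
Qed.

(** ** Initial data *)

Lemma class_R_taylor (rho C : R) (y0 : R -> R) :
  12 < rho -> class_R rho C y0 ->
  exists alpha : nat -> R,
    (forall n : nat, Rabs (alpha n) <= C * INR (fact n) / 12 ^ n) /\
    (forall x : R, 0 <= x <= 1 -> y0 x = taylor alpha x) /\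
    jet0 y0 = alpha.
Proof.
  intros Hrho [alpha [Ha Hs]]; exists alpha.
  assert (HC : 0 <= C).
  { specialize (Ha O); pose proof (Rabs_pos (alpha O)); simpl in Ha; lra. }
  assert (Hb : forall n, Rabs (alpha n) <= C * INR (fact n) / 12 ^ n).
  { intros n; eapply Rle_trans; [apply Ha|]; unfold Rdiv.
    apply Rmult_le_compat_l; [apply Rmult_le_pos; [exact HC|apply pos_INR]|].
    apply Rinv_le_contravar; [apply pow_lt; lra|apply pow_incr; lra]. }
  assert (Hc : taylor_coef (/ 12) C 0 alpha).
  { intros n; rewrite Nat.add_0_r, pow_inv; eapply Rle_trans; [apply Hb|].
    unfold Rdiv; right; ring. }
  assert (Hy : forall x, 0 <= x <= 1 -> y0 x = taylor alpha x).
  { intros x Hx; symmetry; apply is_series_unique.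
    eapply is_series_ext; [|apply (Hs x); lra].
    intros n; simpl; unfold Rdiv; ring. }
  split; [exact Hb|split; [exact Hy|]].
  apply functional_extensionality; intros n; unfold jet0.
  rewrite (derive_in_n_chain 0 1 (fun n => taylor (fun i => alpha (n + i)%nat)) y0); try lra.
  - rewrite taylor_0, Nat.add_0_r; reflexivity.
  - intros k x Hx; apply is_derive_in_of_is_derive.
    replace (fun i => alpha (S k + i)%nat) with (fun i => alpha (k + S i)%nat)
      by (apply functional_extensionality; intros i; f_equal; lia).
    apply (is_derive_taylor (/ 12) (C * (/ 12) ^ k) x (k + 0) (fun i => alpha (k + i)%nat)).
    + lra.
    + apply taylor_coef_shift, Hc.
    + rewrite Rabs_pos_eq; lra.
  - exact Hy.
Qed.

(** * Families of partial derivatives on a rectangle *)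

(** [G p l] is the derivative of [G 0 0] of order p in x and l in t. *)
Definition derivative_family (x1 x2 t1 t2 : R) (G : nat -> nat -> R -> R -> R) : Prop :=
  forall (p l : nat) (x t : R), x1 <= x <= x2 -> t1 <= t <= t2 ->
    is_derive_in x1 x2 (fun z => G p l z t) x (G (S p) l x t) /\
    is_derive_in t1 t2 (fun z => G p l x z) t (G p (S l) x t).

Definition agree_on (x1 x2 t1 t2 : R) (f g : R -> R -> R) : Prop :=
  forall x t : R, x1 <= x <= x2 -> t1 <= t <= t2 -> f x t = g x t.

Lemma partial_x_family (x1 x2 t1 t2 : R) (G : nat -> nat -> R -> R -> R)
    (p l : nat) (f : R -> R -> R) :
  x1 < x2 -> derivative_family x1 x2 t1 t2 G -> agree_on x1 x2 t1 t2 f (G p l) ->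
  agree_on x1 x2 t1 t2 (partial_x x1 x2 f) (G (S p) l).
Proof.
  intros Hx HG Hf x t Hxx Htt; apply derive_in_eq; [exact Hx|exact Hxx|].
  apply (is_derive_in_ext x1 x2 (fun z => G p l z t)); [exact Hxx| |apply HG; assumption].
  intros z Hz; symmetry; apply Hf; assumption.
Qed.

Lemma partial_t_family (x1 x2 t1 t2 : R) (G : nat -> nat -> R -> R -> R)
    (p l : nat) (f : R -> R -> R) :
  t1 < t2 -> derivative_family x1 x2 t1 t2 G -> agree_on x1 x2 t1 t2 f (G p l) ->
  agree_on x1 x2 t1 t2 (partial_t t1 t2 f) (G p (S l)).
Proof.
  intros Ht HG Hf x t Hxx Htt; apply derive_in_eq; [exact Ht|exact Htt|].
  apply (is_derive_in_ext t1 t2 (fun z => G p l x z)); [exact Htt| |apply HG; assumption].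
  intros z Hz; symmetry; apply Hf; assumption.
Qed.

Lemma iter_partial_family (x1 x2 t1 t2 : R) (G : nat -> nat -> R -> R -> R)
    (f : R -> R -> R) (p l : nat) :
  x1 < x2 -> t1 < t2 -> derivative_family x1 x2 t1 t2 G ->
  agree_on x1 x2 t1 t2 f (G O O) ->
  agree_on x1 x2 t1 t2
    (Nat.iter p (partial_x x1 x2) (Nat.iter l (partial_t t1 t2) f)) (G p l).
Proof.
  intros Hx Ht HG Hf; induction p as [|p IH].
  - induction l as [|l IH]; [exact Hf|].
    apply (partial_t_family x1 x2 t1 t2 G 0 l); assumption.
  - apply (partial_x_family x1 x2 t1 t2 G p l); assumption.
Qed.

Lemma class_C_family (x1 x2 t1 t2 : R) (G : nat -> nat -> R -> R -> R)
    (B : nat -> nat -> R) (k p l : nat) (f : R -> R -> R) :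
  x1 < x2 -> t1 < t2 -> derivative_family x1 x2 t1 t2 G ->
  (forall (p l : nat) (x t : R), x1 <= x <= x2 -> t1 <= t <= t2 ->
     Rabs (G p l x t) <= B p l) ->
  agree_on x1 x2 t1 t2 f (G p l) -> class_C k x1 x2 t1 t2 f.
Proof.
  intros Hx Ht HG HB; revert p l f.
  (* The bounds on the first derivatives make f Lipschitz continuous. *)
  assert (Hcont : forall p l f, agree_on x1 x2 t1 t2 f (G p l) ->
    continuous_on (fun q : R * R => x1 <= fst q <= x2 /\ t1 <= snd q <= t2)
      (fun q : R * R => f (fst q) (snd q))).
  { intros p l f Hf [x t] [Hxx Htt]; simpl in Hxx, Htt.
    apply filterlim_locally; intros eps.
    set (L := B (S p) l + B p (S l)).
    assert (HL1 : 0 <= B (S p) l)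
      by (eapply Rle_trans; [apply Rabs_pos|apply (HB (S p) l x t Hxx Htt)]).
    assert (HL2 : 0 <= B p (S l))
      by (eapply Rle_trans; [apply Rabs_pos|apply (HB p (S l) x t Hxx Htt)]).
    assert (Hd : 0 < eps / (L + 1))
      by (apply Rdiv_lt_0_compat; [apply cond_pos|unfold L; lra]).
    exists (mkposreal _ Hd); intros [x' t'] [Hbx Hbt] [Hx' Ht'].
    simpl in Hx', Ht'; simpl fst in *; simpl snd in *.
    unfold ball in *; simpl in *; unfold AbsRing_ball, abs, minus, plus, opp in *;
      simpl in *.
    rewrite !Hf by assumption.
    assert (E1 : Rabs (G p l x' t' - G p l x t') <= B (S p) l * Rabs (x' - x)).
    { apply (lipschitz_of_derive_in x1 x2 _ (fun z => G p l z t') (fun z => G (S p) l z t'));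
        try assumption; intros z Hz; [apply HG|apply HB]; assumption. }
    assert (E2 : Rabs (G p l x t' - G p l x t) <= B p (S l) * Rabs (t' - t)).
    { apply (lipschitz_of_derive_in t1 t2 _ (fun z => G p l x z) (fun z => G p (S l) x z));
        try assumption; intros z Hz; [apply HG|apply HB]; assumption. }
    replace (G p l x' t' + - G p l x t)
      with ((G p l x' t' - G p l x t') + (G p l x t' - G p l x t)) by ring.
    eapply Rle_lt_trans; [apply Rabs_triang|].
    assert (Heps : (L + 1) * (eps / (L + 1)) = eps) by (field; unfold L; lra).
    unfold Rminus in *; set (e := eps / (L + 1)) in *.
    assert (B (S p) l * Rabs (x' + - x) <= B (S p) l * e)
      by (apply Rmult_le_compat_l; lra).
    assert (B p (S l) * Rabs (t' + - t) <= B p (S l) * e)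
      by (apply Rmult_le_compat_l; lra).
    rewrite <- Heps; unfold L; lra. }
  induction k as [|k IH]; intros p l f Hf; split; try exact I; try (eapply Hcont, Hf).
  split; [|split].
  - intros x t Hxx Htt; split.
    + exists (G (S p) l x t).
      apply (is_derive_in_ext x1 x2 (fun z => G p l z t)); [exact Hxx| |apply HG; assumption].
      intros z Hz; symmetry; apply Hf; assumption.
    + exists (G p (S l) x t).
      apply (is_derive_in_ext t1 t2 (fun z => G p l x z)); [exact Htt| |apply HG; assumption].
      intros z Hz; symmetry; apply Hf; assumption.
  - apply (IH (S p) l), partial_x_family; assumption.
  - apply (IH p (S l)), partial_t_family; assumption.
Qed.

(** * Solving the equation from the trace at x = 0 *)

(** The derivatives of the solution, of order p in x and l in t: its Taylor series
    in x at 0 has the coefficients [xjet] of the trace at time t. *)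
Definition xsol (th : nat -> R -> R) (p l : nat) (x t : R) : R :=
  taylor (fun n => xjet (fun j => th j t) (p + n) l) x.

Section Trace.

Variables (T A : R) (th : nat -> R -> R).
Hypothesis A_small : 0 <= A <= / 4.
Hypothesis th_chain : derivative_chain 0 T th.
Hypothesis th_bound : forall (l : nat) (t : R), 0 <= t <= T ->
  Rabs (th l t) <= A * (19 / 20) ^ 2 * (3 / 4) ^ l * INR (fact (3 * l + 3)).

Lemma xsol_coef (p l : nat) (t : R) : 0 <= t <= T ->
  taylor_coef (19 / 20) (A * (19 / 20) ^ p * (3 / 4) ^ l) (p + (3 * l + 1))
    (fun n => xjet (fun j => th j t) (p + n) l).
Proof.
  intros Ht n; eapply Rle_trans; [apply (xjet_bound _ A A_small)|].
  - intros j; apply th_bound, Ht.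
  - replace (p + n + 3 * l + 1)%nat with (n + (p + (3 * l + 1)))%nat by lia.
    rewrite pow_add; right; ring.
Qed.

Lemma xsol_bound (p l : nat) (x t : R) : 0 <= x <= 1 -> 0 <= t <= T ->
  Rabs (xsol th p l x t) <= A * (1600 * 40 ^ p * (64000 * 108) ^ l
    * (INR (fact p) * INR (fact l) ^ 3)).
Proof.
  intros Hx Ht.
  eapply Rle_trans;
    [apply (taylor_bound (19 / 20) _ x _ _ ltac:(lra) (xsol_coef p l t Ht));
     rewrite Rabs_pos_eq; lra|].
  set (q := (3 * l + 1)%nat).
  (* 2^(p+q) bounds a binomial coefficient; the extra factor 2 comes from taking it
     as a term of the series of rise q p / 2^p. *)
  assert (Hfact : INR (fact (p + q)) <= INR (fact p) * (INR (fact q) * 2 ^ S (p + q))).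
  { pose proof (INR_fact_pos p) as Hp.
    assert (H : rise q p * (/ 2) ^ p <= INR (fact q) * 2 ^ S q).
    { rewrite <- Series_rise.
      apply (is_series_term_le (fun l => rise q l * (/ 2) ^ l)).
      - intros i; apply Rmult_le_pos; [left; apply rise_pos|apply pow_le; lra].
      - apply Series_correct, ex_series_rise. }
    assert (H2 : 0 < 2 ^ p) by (apply pow_lt; lra).
    apply (Rmult_le_compat_r (INR (fact p) * 2 ^ p)) in H; [|apply Rmult_le_pos; lra].
    replace (INR (fact (p + q))) with (rise q p * (/ 2) ^ p * (INR (fact p) * 2 ^ p)).
    - eapply Rle_trans; [exact H|]; simpl pow; rewrite pow_add; right; ring.
    - rewrite pow_inv; unfold rise; field; split; lra. }
  assert (Hq : INR (fact q) <= 4 ^ l * (27 ^ l * INR (fact l) ^ 3)).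
  { unfold q; rewrite Nat.add_1_r, INR_fact_S.
    pose proof (pos_INR (3 * l)); pose proof (INR_fact_pos (3 * l)).
    apply Rmult_le_compat; [lra|lra| |apply fact_3_le].
    clear; induction l as [|l IH]; [simpl; lra|].
    rewrite mult_INR in *; rewrite (S_INR l); replace (INR 3) with 3 in * by (simpl; ring).
    simpl pow; pose proof (pos_INR l); lra. }
  replace (1 - 19 / 20) with (/ 20) by field.
  assert (H20 : 0 < 20 ^ S (p + q)) by (apply pow_lt; lra).
  assert (H2 : 0 < 2 ^ S (p + q)) by (apply pow_lt; lra).
  assert (Hz : 0 < (19 / 20) ^ p <= 1).
  { split; [apply pow_lt; lra|]; rewrite <- (pow1 p); apply pow_incr; lra. }
  assert (Hy : 0 < (3 / 4) ^ l <= 1).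
  { split; [apply pow_lt; lra|]; rewrite <- (pow1 l); apply pow_incr; lra. }
  assert (Hzy : 0 <= (19 / 20) ^ p * (3 / 4) ^ l <= 1) by (split; nra).
  rewrite pow_inv; unfold Rdiv at 3; rewrite Rinv_inv.
  pose proof (INR_fact_pos p) as Hp.
  assert (Hl : 0 < INR (fact l) ^ 3) by (apply pow_lt, INR_fact_pos).
  set (X := INR (fact p) * (4 ^ l * (27 ^ l * INR (fact l) ^ 3) * 2 ^ S (p + q))
              * 20 ^ S (p + q)).
  assert (HX : INR (fact (p + q)) * 20 ^ S (p + q) <= X).
  { unfold X; apply Rmult_le_compat_r; [lra|].
    eapply Rle_trans; [exact Hfact|].
    apply Rmult_le_compat_l; [lra|]; apply Rmult_le_compat_r; lra. }
  assert (HX0 : 0 <= X).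
  { eapply Rle_trans; [|exact HX]; apply Rmult_le_pos; [apply pos_INR|lra]. }
  replace (1600 * 40 ^ p * (64000 * 108) ^ l * (INR (fact p) * INR (fact l) ^ 3)) with X.
  - rewrite !Rmult_assoc; apply Rmult_le_compat_l; [lra|].
    rewrite <- Rmult_assoc.
    apply Rle_trans with (1 * X); [|lra].
    apply Rmult_le_compat; [lra|apply Rmult_le_pos; [apply pos_INR|lra]|lra|exact HX].
  - assert (H40 : 2 ^ S (p + q) * 20 ^ S (p + q) = 1600 * 40 ^ p * 64000 ^ l).
    { rewrite <- Rpow_mult_distr; replace (2 * 20) with 40 by ring; unfold q.
      replace (S (p + (3 * l + 1))) with (2 + p + 3 * l)%nat by lia.
      rewrite !pow_add, pow_mult; f_equal; [f_equal|f_equal]; simpl; ring. }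
    assert (H108 : 4 ^ l * 27 ^ l = 108 ^ l)
      by (rewrite <- Rpow_mult_distr; f_equal; ring).
    rewrite Rpow_mult_distr, <- H108; unfold X.
    replace (INR (fact p) * (4 ^ l * (27 ^ l * INR (fact l) ^ 3) * 2 ^ S (p + q)) * 20 ^ S (p + q))
      with (INR (fact p) * (4 ^ l * (27 ^ l * INR (fact l) ^ 3)) *
             (2 ^ S (p + q) * 20 ^ S (p + q))) by ring.
    rewrite H40; ring.
Qed.

Lemma xsol_family : derivative_family 0 1 0 T (xsol th).
Proof.
  intros p l x t Hx Ht; split.
  - apply is_derive_in_of_is_derive; unfold xsol.
    replace (fun n => xjet (fun j => th j t) (S p + n) l)
      with (fun n => xjet (fun j => th j t) (p + S n) l)
      by (apply functional_extensionality; intros n; f_equal; lia).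
    apply (is_derive_taylor (19 / 20) _ x _ (fun n => xjet (fun j => th j t) (p + n) l)
             ltac:(lra) (xsol_coef p l t Ht)).
    rewrite Rabs_pos_eq; lra.
  - apply (is_derive_in_series 0 T
      (fun n t => xjet (fun j => th j t) (p + n) l / INR (fact n) * x ^ n)
      (fun n t => xjet (fun j => th j t) (p + n) (S l) / INR (fact n) * x ^ n)
      (fun n => A * (19 / 20) ^ p * (3 / 4) ^ S l *
                  (rise (p + (3 * S l + 1)) n * (19 / 20) ^ n))); [| | | |exact Ht].
    + intros n s Hs.
      replace (xjet (fun j => th j s) (p + n) (S l) / INR (fact n) * x ^ n)
        with (x ^ n / INR (fact n) * xjet (fun j => th j s) (p + n) (S l))
        by (unfold Rdiv; ring).
      apply (is_derive_in_ext 0 T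
        (fun s => x ^ n / INR (fact n) * xjet (fun j => th j s) (p + n) l)); [exact Hs| |].
      * intros z _; unfold Rdiv; ring.
      * apply is_derive_in_scal.
        apply (is_derive_in_xjet 0 T s (fun s j => th j s)).
        intros j; apply th_chain, Hs.
    + intros n s Hs.
      eapply (taylor_term_bound _ _ _ _ (fun n => xjet (fun j => th j s) (p + n) (S l)));
        [apply xsol_coef, Hs|rewrite Rabs_pos_eq; lra].
    + apply (ex_series_scal_l (A * (19 / 20) ^ p * (3 / 4) ^ S l)
               (fun n => rise (p + (3 * S l + 1)) n * (19 / 20) ^ n)).
      eexists; apply is_series_rise; lra.
    + intros s Hs; eapply ex_series_bounded.
      * intros n.
        eapply (taylor_term_bound _ _ _ _ (fun n => xjet (fun j => th j s) (p + n) l));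
          [apply xsol_coef, Hs|rewrite Rabs_pos_eq; lra].
      * apply (ex_series_scal_l (A * (19 / 20) ^ p * (3 / 4) ^ l)
               (fun n => rise (p + (3 * l + 1)) n * (19 / 20) ^ n)).
        eexists; apply is_series_rise; lra.
Qed.

(** The nonlinear term is recovered as a Cauchy product.  Its Taylor coefficients
    are, by the recursion, a combination of coefficients already estimated. *)
Lemma xsol_equation (x t : R) : 0 <= x <= 1 -> 0 <= t <= T ->
  xsol th 0 1 x t = xsol th 3 0 x t + xsol th 1 0 x t + xsol th 0 0 x t * xsol th 1 0 x t.
Proof.
  intros Hx Ht; set (u := xjet (fun j => th j t)).
  assert (Hx1 : Rabs x <= 1) by (rewrite Rabs_pos_eq; lra).
  assert (Hz : 0 < 19 / 20 < 1) by lra.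
  pose proof (fun p l => xsol_coef p l t Ht) as Hc; fold u in Hc.
  assert (Hmul : taylor (leib (fun n => u n O) (fun n => u (S n) O)) x =
                 xsol th 0 0 x t * xsol th 1 0 x t)
    by exact (taylor_mult _ _ _ x _ _ _ _ Hz (Hc O O) (Hc 1%nat O) Hx1).
  assert (Hsum : taylor (fun n => u n 1%nat - u (S (S (S n))) O - u (S n) O) x =
                 xsol th 0 1 x t - xsol th 3 0 x t - xsol th 1 0 x t)
    by exact (taylor_minus2 _ _ _ _ x _ _ _ _ _ _ Hz (Hc O 1%nat) (Hc 3%nat O) (Hc 1%nat O) Hx1).
  replace (leib (fun n => u n O) (fun n => u (S n) O))
    with (fun n => u n 1%nat - u (S (S (S n))) O - u (S n) O) in Hmul.
  - rewrite Hmul in Hsum; lra.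
  - apply functional_extensionality; intros n.
    pose proof (xjet_eq (fun j => th j t) (S (S (S n))) 0) as H; fold u in H.
    unfold xstep in H; rewrite leib2_t_O in H; unfold shx in H; rewrite H; ring.
Qed.

End Trace.

(** * Exact controllability *)

Lemma Rpower_3 (x : R) : 0 < x -> Rpower x 3 = x ^ 3.
Proof.
  intros Hx; rewrite <- (Rpower_pow 3 x Hx); f_equal; simpl; ring.
Qed.

Lemma gevrey2_of_family (T M a b : R) (G : nat -> nat -> R -> R -> R) (y : R -> R -> R) :
  0 < T -> 0 < M -> 0 < a -> 0 < b -> derivative_family 0 1 0 T G ->
  (forall (p l : nat) (x t : R), 0 <= x <= 1 -> 0 <= t <= T ->
     Rabs (G p l x t) <= M * a ^ p * b ^ l * (INR (fact p) * INR (fact l) ^ 3)) ->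
  agree_on 0 1 0 T y (G O O) -> gevrey2 1 3 0 1 0 T y.
Proof.
  intros HT HM Ha Hb HG HB Hy; split.
  - intros k; apply (class_C_family 0 1 0 T G _ k 0 0 y ltac:(lra) HT HG HB Hy).
  - exists M, (/ a), (/ b).
    split; [exact HM|]; split; [apply Rinv_0_lt_compat, Ha|].
    split; [apply Rinv_0_lt_compat, Hb|]; intros p l x t Hx Ht.
    rewrite (iter_partial_family 0 1 0 T G y p l ltac:(lra) HT HG Hy x t Hx Ht).
    eapply Rle_trans; [apply HB; assumption|].
    rewrite Rpower_1, Rpower_3 by apply INR_fact_pos; rewrite !pow_inv.
    right; field; split; apply pow_nonzero; lra.
Qed.

Lemma gevrey_of_chain (T M b : R) (F : nat -> R -> R) (h : R -> R) :
  0 < T -> 0 < M -> 0 < b -> derivative_chain 0 T F ->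
  (forall (l : nat) (t : R), 0 <= t <= T ->
     Rabs (F l t) <= M * b ^ l * INR (fact l) ^ 3) ->
  (forall t : R, 0 <= t <= T -> h t = F O t) -> gevrey 3 0 T h.
Proof.
  intros HT HM Hb HF HB Hh; split.
  - apply (smooth_in_chain 0 T F); assumption.
  - exists M, (/ b); split; [exact HM|]; split; [apply Rinv_0_lt_compat, Hb|].
    intros l t Ht; rewrite (derive_in_n_chain 0 T F h HT HF Hh l t Ht).
    eapply Rle_trans; [apply HB, Ht|].
    rewrite Rpower_3 by apply INR_fact_pos; rewrite pow_inv.
    right; field; apply pow_nonzero; lra.
Qed.

Lemma radius_gt_12 (rho : R) : rho > 12 * exp (/ (3 * exp 1)) -> 12 < rho.
Proof.
  intros H; pose proof (exp_pos 1).
  assert (0 < / (3 * exp 1)) by (apply Rinv_0_lt_compat; lra).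
  pose proof (exp_ineq1_le (/ (3 * exp 1))); lra.
Qed.

Lemma trace_coef (alpha : nat -> R) (A : R) :
  0 <= A <= / 12 ->
  (forall n : nat, Rabs (alpha n) <= A * INR (fact n) / 12 ^ n) ->
  forall l : nat,
    Rabs (tjet alpha 2 l) <= A / 144 * (7 / 864) ^ l * INR (fact (3 * l + 3)).
Proof.
  intros HA Ha l; eapply Rle_trans; [apply (tjet_bound alpha A HA Ha)|].
  replace (2 + 3 * l + 1)%nat with (3 * l + 3)%nat by lia; right; simpl pow; field.
Qed.

Theorem theorem2p2 :
  forall rho T : R,
    rho > 12 * exp (/ (3 * exp 1)) -> T > 0 ->
    exists C : R, C > 0 /\
      forall y0 y0' : R -> R,
        class_R rho C y0 -> compatible y0 ->
        class_R rho C y0' -> compatible y0' ->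
        exists (y : R -> R -> R) (h : R -> R),
          gevrey2 1 3 0 1 0 T y /\
          gevrey 3 0 T h /\
          (forall x t : R, 0 <= x <= 1 -> 0 <= t <= T ->
             partial_t 0 T y x t =
               Nat.iter 3 (partial_x 0 1) y x t + partial_x 0 1 y x t
               + y x t * partial_x 0 1 y x t) /\
          (forall t : R, 0 <= t <= T ->
             y 1 t = h t /\ y 0 t = 0 /\ partial_x 0 1 y 0 t = 0) /\
          (forall x : R, 0 <= x <= 1 -> y x 0 = y0 x) /\
          (forall x : R, 0 <= x <= 1 -> y x T = y0' x).
Proof.
  intros rho T Hrho HT; apply radius_gt_12 in Hrho; apply Rgt_lt in HT.
  destruct (two_point_borel T HT) as [K [HK Hborel]].
  (* The trace is bounded by K C / 144 times the weight in which it has to be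
     below (19 / 20) ^ 2 / 4. *)
  set (C := Rmin (/ 12) (36 * (19 / 20) ^ 2 / K)).
  assert (HC : 0 < C).
  { apply Rmin_glb_lt; [lra|apply Rdiv_lt_0_compat; lra]. }
  assert (HC12 : 0 <= C <= / 12) by (split; [lra|apply Rmin_l]).
  assert (HCK : K * C <= 36 * (19 / 20) ^ 2).
  { apply Rle_trans with (K * (36 * (19 / 20) ^ 2 / K)).
    - apply Rmult_le_compat_l; [lra|apply Rmin_r].
    - right; field; lra. }
  exists C; split; [exact HC|]; intros y0 y0' Hy0 [_ Hc0] Hy0' [_ Hc0'].
  destruct (class_R_taylor rho C y0 Hrho Hy0) as [alpha [Ha [Hya Hja]]].
  destruct (class_R_taylor rho C y0' Hrho Hy0') as [alpha' [Ha' [Hya' Hja']]].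
  rewrite Hja in Hc0; rewrite Hja' in Hc0'.
  destruct (Hborel (tjet alpha 2) (tjet alpha' 2) (C / 144)
    (trace_coef alpha C HC12 Ha) (trace_coef alpha' C HC12 Ha'))
    as [th [Hth [Hth0 [HthT Hthb]]]].
  set (A := K * (C / 144) / (19 / 20) ^ 2).
  assert (HA : 0 < A <= / 4).
  { unfold A; split; [apply Rdiv_lt_0_compat; [apply Rmult_lt_0_compat|]; lra|lra]. }
  assert (HAb : forall l t, 0 <= t <= T ->
    Rabs (th l t) <= A * (19 / 20) ^ 2 * (3 / 4) ^ l * INR (fact (3 * l + 3))).
  { intros l t Ht; eapply Rle_trans; [apply Hthb, Ht|].
    replace (A * (19 / 20) ^ 2) with (K * (C / 144)) by (unfold A; field); lra. }
  assert (HA' : 0 <= A <= / 4) by lra.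
  pose proof (xsol_family T A th HA' Hth HAb) as HG.
  set (y := xsol th 0 0).
  assert (Hagree : agree_on 0 1 0 T y (xsol th 0 0)) by (intros x t _ _; reflexivity).
  assert (HG1 : forall p x t, 0 <= x <= 1 -> 0 <= t <= T ->
            Nat.iter p (partial_x 0 1) y x t = xsol th p 0 x t).
  { intros p; apply (iter_partial_family 0 1 0 T (xsol th) y p 0); auto; lra. }
  assert (HGx : forall x t, 0 <= x <= 1 -> 0 <= t <= T ->
            partial_x 0 1 y x t = xsol th 1 0 x t) by exact (HG1 1%nat).
  assert (HGt : forall x t, 0 <= x <= 1 -> 0 <= t <= T ->
            partial_t 0 T y x t = xsol th 0 1 x t)
    by (apply (partial_t_family 0 1 0 T (xsol th) 0 0 y); assumption).
  assert (HM : 0 < A * 1600) by lra.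
  assert (Hb : 0 < 64000 * 108) by lra.
  assert (Hbound : forall p l x t, 0 <= x <= 1 -> 0 <= t <= T ->
    Rabs (xsol th p l x t) <= A * 1600 * 40 ^ p * (64000 * 108) ^ l
      * (INR (fact p) * INR (fact l) ^ 3)).
  { intros p l x t Hx Ht; eapply Rle_trans;
      [apply (xsol_bound T A th HA' HAb p l x t Hx Ht)|right; ring]. }
  (* At both ends of [0, T] the trace has the jet of compatible data. *)
  assert (Hjet : forall t beta, (forall n, th n t = tjet beta 2 n) ->
    (forall l, jeval beta (J1 l) = 0 /\ jeval beta (J2 l) = 0) ->
    forall x, y x t = taylor beta x).
  { intros t beta Ht Hc x; unfold y, xsol; f_equal.
    apply functional_extensionality; intros n.
    rewrite (functional_extensionality _ _ Ht), tjet_eq_xjet, tjet_O; auto. }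
  exists y, (fun t => y 1 t).
  split; [|split; [|split; [|split; [|split]]]].
  - apply (gevrey2_of_family T (A * 1600) 40 (64000 * 108) (xsol th)); auto; lra.
  - apply (gevrey_of_chain T (A * 1600) (64000 * 108) (fun l => xsol th 0 l 1)); auto.
    + intros l t Ht; apply HG; lra.
    + intros l t Ht; eapply Rle_trans; [apply Hbound; lra|]; simpl (INR (fact 0)).
      right; ring.
  - intros x t Hx Ht.
    rewrite (HG1 3%nat), HGx, HGt by assumption.
    apply (xsol_equation T A th HA' HAb); assumption.
  - intros t Ht; split; [reflexivity|]; split.
    + unfold y, xsol; rewrite taylor_0, xjet_eq; reflexivity.
    + rewrite HGx by lra.
      unfold xsol; rewrite taylor_0, xjet_eq; reflexivity.
  - intros x Hx; rewrite (Hya x Hx); apply Hjet; assumption.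
  - intros x Hx; rewrite (Hya' x Hx); apply Hjet; assumption.
Qed.
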